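(* Let $\mathcal S\subset\mathbb P^4_{\mathbb Q}$, with homogeneous coordinates $[a:b:c:u:v]$, be the complete intersection defined by $$a^2+b^2+c^2=u^2+v^2,\qquad a^4+b^4+c^4=u^4+v^4,$$ and let $\mathcal S^\circ\subset\mathcal S$ be the open subset where $a,b,c,u,v$ are all nonzero and the squares $a^2,b^2,c^2,u^2,v^2$ are pairwise distinct. For $P=[a:b:c:u:v]\in\mathcal S^\circ(\mathbb Q)$ let $X_P$ be the smooth projective genus-two curve over $\mathbb Q$ with affine model $$X_P:\quad y^2=x(x-a^2)(x-b^2)(x-c^2)(x-u^2)(x-v^2).$$ Then for every $P\in\mathcal S^\circ(\mathbb Q)$ there is an injective group homomorphism $$\mathbb Z/2\mathbb Z\times\mathbb Z/2\mathbb Z\times\mathbb Z/2\mathbb Z\times\mathbb Z/12\mathbb Z\hookrightarrow \operatorname{Jac}(X_P)(\mathbb Q).$$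
   Context: $\operatorname{Jac}(X)$ denotes the Jacobian of a smooth projective curve $X$. The representative $(a,b,c,u,v)$ of $P$ is taken with rational coordinates; rescaling it gives an isomorphic curve. *)

(* Defs.v *)
From HB Require Import structures.
From mathcomp Require Import all_boot all_order all_algebra all_field.
From mathcomp Require Import ring_quotient qpoly boolp.
From mathcomp.multinomials Require Import freeg.

Set Implicit Arguments.
Unset Strict Implicit.
Unset Printing Implicit Defensive.

Import GRing.Theory.

Local Open Scope ring_scope.
Local Open Scope quotient_scope.

(** For f : {poly rat} separable of degree 6, let X be the smooth projective
    genus-two curve over Q with affine model y^2 = f(x).  We define Jac(X)(Q)
    as the group of classes in Pic^0(X_Qbar) fixed by Gal(Qbar/Q), where
    Qbar = algC.  The definitions make sense for every f, but they describe a
    smooth curve only when f is separable of degree 6. *)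
Section Curve.

Variable f : {poly rat}.

Local Notation fbar := (map_poly ratr f : {poly algC}).

(** Qbar(X) = Qbar(x)[y] / (y^2 - f(x)).  The library makes this quotient only
    a commutative ring with units; it is a field as soon as f is not a square in
    algC[x], and then being a unit means being nonzero. *)
Definition function_field : Type :=
  {poly %/ ('X^2 - (FracField.tofrac fbar)%:P : {poly {fraction {poly algC}}})}.

HB.instance Definition _ := GRing.ComUnitRing.on function_field.

Definition ff_of_ratfun (r : {fraction {poly algC}}) : function_field :=
  qpolyC _ r.

HB.instance Definition _ :=
  GRing.RMorphism.copy ff_of_ratfun (qpolyC
    ('X^2 - (FracField.tofrac fbar)%:P : {poly {fraction {poly algC}}})).

Definition ff_const : algC -> function_field :=
  ff_of_ratfun \o (@FracField.tofrac {poly algC} \o polyC).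

HB.instance Definition _ := GRing.RMorphism.on ff_const.

Definition ff_x : function_field := ff_of_ratfun (FracField.tofrac 'X).
Definition ff_y : function_field := in_qpoly _ 'X.

(** X_Qbar is glued from the affine curves y^2 = f(x) and w^2 = t^6 f(1/t) along
    t = 1/x, w = y/x^3.  The points missing from the first chart are those with
    t = 0, where w^2 is the coefficient of x^6 in f. *)
Definition affine_point : Type :=
  {p : algC * algC | p.2 ^+ 2 == fbar.[p.1]}.
Definition infinite_point : Type := {s : algC | s ^+ 2 == fbar`_6}.

HB.instance Definition _ := Choice.on affine_point.
HB.instance Definition _ := Choice.on infinite_point.

Definition point : Type := (affine_point + infinite_point)%type.

HB.instance Definition _ := Choice.on point.

(** [h] is a unit of the local ring at the point (p0, q0) of the affine chart
    whose coordinate functions are [p] and [q]: it is A(p, q) / B(p, q) with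
    neither A nor B vanishing at (p0, q0). *)
Definition local_unit (p q : function_field) (p0 q0 : algC)
    (h : function_field) : Prop :=
  exists A B : {poly {poly algC}},
    [/\ A.[p0, q0] != 0, B.[p0, q0] != 0 &
        h * (map_poly (map_poly ff_const) B).[p, q] =
        (map_poly (map_poly ff_const) A).[p, q]].

(** ord_P(h) = n.  The local parameter is x - x(P) at an affine point with
    y(P) <> 0, y at an affine point with y(P) = 0, and 1/x at infinity. *)
Definition has_order (P : point) (h : function_field) (n : int) : Prop :=
  match P with
  | inl p =>
      let: (x0, y0) := val p in
      let pi := if y0 == 0 then ff_y else ff_x - ff_const x0 in
      exists2 v, local_unit ff_x ff_y x0 y0 v & h = pi ^ n * v
  | inr s =>
      exists2 v, local_unit ff_x^-1 (ff_y / ff_x ^+ 3) 0 (val s) v &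
                 h = ff_x^-1 ^ n * v
  end.

Definition divisor : Type := {freeg point / int}.

HB.instance Definition _ := GRing.Lmodule.on divisor.

Definition principal : {pred divisor} := fun D =>
  `[< exists2 h : function_field, h \is a GRing.unit &
        forall P, has_order P h (coeff P D) >].

Lemma local_unit1 p q p0 q0 : local_unit p q p0 q0 1.
Proof.
by exists 1, 1; split; rewrite ?rmorph1 ?hornerC ?hornerE ?oner_eq0.
Qed.

Lemma local_unit_div p q p0 q0 v1 v2 : v2 \is a GRing.unit ->
  local_unit p q p0 q0 v1 -> local_unit p q p0 q0 v2 ->
  local_unit p q p0 q0 (v1 / v2).
Proof.
move=> uv2 [A1 [B1 [A1n B1n e1]]] [A2 [B2 [A2n B2n e2]]].
exists (A1 * B2), (B1 * A2); rewrite !rmorphM !hornerM !mulf_neq0 //; split=> //.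
by rewrite -e1 -e2 mulrACA [v2 * _]mulrC [v2^-1 * _]mulrC mulrK.
Qed.

Lemma expfz_sub_div (pi h1 h2 v1 v2 : function_field) (m n : int) :
  h1 \is a GRing.unit -> h2 \is a GRing.unit ->
  h1 = pi ^ m * v1 -> h2 = pi ^ n * v2 ->
  v2 \is a GRing.unit /\ h1 / h2 = pi ^ (m - n) * (v1 / v2).
Proof.
move=> u1 u2 e1 e2.
have upi (k : int) h v : h \is a GRing.unit -> h = pi ^ k * v ->
    k = 0 \/ pi \is a GRing.unit.
  move=> uh e; move: uh; rewrite {}e unitrM => /andP[+ _].
  case: k => [[|k]|k]; first by left.
  - by rewrite -exprnP unitrX_pos //; right.
  - by rewrite NegzE -exprnN unitrV unitrX_pos //; right.
have uv2 : v2 \is a GRing.unit by move: u2; rewrite e2 unitrM => /andP[].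
have upn : pi ^ n \is a GRing.unit by move: u2; rewrite e2 unitrM => /andP[].
split=> //; rewrite e1 e2 invrM //.
have -> : pi ^ (m - n) = pi ^ m / pi ^ n.
  case: (upi _ _ _ u2 e2) => [->|upi']; first by rewrite subr0 expr0z divr1.
  by rewrite exprzDr // invr_expz.
by rewrite [v2^-1 * _]mulrC mulrACA.
Qed.

Lemma principal_zmod_closed : zmod_closed principal.
Proof.
split=> [|D1 D2 /asboolP[h1 u1 o1] /asboolP[h2 u2 o2]].
  apply/asboolP; exists 1; first exact: unitr1.
  case=> [[[x0 y0] P0]|s] /=; rewrite coeff0; exists 1;
    rewrite ?expr0z ?mulr1 //; exact: local_unit1.
apply/asboolP; exists (h1 / h2); first by rewrite unitrM u1 unitrV.
move=> P; move: (o1 P) (o2 P); rewrite coeffB.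
case: P => [[[x0 y0] P0]|s] /= [v1 l1 e1] [v2 l2 e2];
  have [uv2 e] := expfz_sub_div u1 u2 e1 e2; exists (v1 / v2) => //;
  exact: local_unit_div.
Qed.

HB.instance Definition _ :=
  GRing.isZmodClosed.Build divisor principal principal_zmod_closed.

Definition Pic : Type := {ideal_quot principal}.

HB.instance Definition _ := GRing.Zmodule.on Pic.
HB.instance Definition _ := Quotient.on Pic.

Definition divisor_class (D : divisor) : Pic := \pi_{ideal_quot principal} D.

(** Gal(Qbar/Q) is the set of all ring endomorphisms of algC, which are
    automatically bijective.  It acts on points through their coordinates. *)
Lemma fbar_conj (sigma : {rmorphism algC -> algC}) : map_poly sigma fbar = fbar.
Proof.
rewrite -map_poly_comp; apply: eq_map_poly => q /=.
exact: fmorph_eq_rat (sigma \o ratr) q.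
Qed.

Fact affine_conj_proof (sigma : {rmorphism algC -> algC}) (p : affine_point) :
  sigma (val p).2 ^+ 2 == fbar.[sigma (val p).1].
Proof.
have := horner_map sigma fbar (val p).1; rewrite fbar_conj => ->.
by rewrite -rmorphXn (eqP (valP p)).
Qed.

Fact infinite_conj_proof (sigma : {rmorphism algC -> algC})
    (s : infinite_point) : sigma (val s) ^+ 2 == fbar`_6.
Proof.
have := coef_map sigma fbar 6; rewrite fbar_conj => e.
by rewrite -rmorphXn (eqP (valP s)) -e.
Qed.

Definition conj_point (sigma : {rmorphism algC -> algC}) (P : point) : point :=
  match P with
  | inl p => inl (exist _ (sigma (val p).1, sigma (val p).2)
                    (affine_conj_proof sigma p))
  | inr s => inr (exist _ (sigma (val s)) (infinite_conj_proof sigma s))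
  end.

Definition conj_divisor (sigma : {rmorphism algC -> algC}) (D : divisor)
    : divisor :=
  fglift (fun P => << conj_point sigma P >> : divisor) D.

(** The classes c in Pic^0(X_Qbar) with sigma(c) = c for every sigma. *)
Definition rational_class0 : {pred Pic} := fun c =>
  `[< exists D : divisor,
        [/\ c = divisor_class D, deg D = 0 &
            forall sigma : {rmorphism algC -> algC},
              divisor_class (conj_divisor sigma D) = divisor_class D] >].

Lemma divisor_classB : {morph divisor_class : D1 D2 / D1 - D2}.
Proof. by move=> D1 D2; rewrite /divisor_class raddfB. Qed.

Lemma rational_class0_zmod_closed : zmod_closed rational_class0.
Proof.
have conjB sigma : {morph conj_divisor sigma : D1 D2 / D1 - D2}.
  by move=> D1 D2; rewrite /conj_divisor lift_is_additive.
split=> [|c1 c2 /asboolP[D1 [-> d1 g1]] /asboolP[D2 [-> d2 g2]]]; apply/asboolP.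
  exists 0; split=> [||sigma]; rewrite ?deg0 //.
    by rewrite -[0 in RHS](subrr 0) divisor_classB subrr.
  by rewrite -[X in conj_divisor _ X](subrr 0) conjB subrr.
exists (D1 - D2); split=> [||sigma]; first by rewrite divisor_classB.
  by rewrite degB d1 d2 subrr.
by rewrite conjB !divisor_classB g1 g2.
Qed.

HB.instance Definition _ :=
  GRing.isZmodClosed.Build Pic rational_class0 rational_class0_zmod_closed.

(** Jac(X)(Q) *)
Record jacobian_rat_points :=
  JacPoint { jac_class : Pic; _ : jac_class \in rational_class0 }.

HB.instance Definition _ := [isSub for jac_class].
HB.instance Definition _ := [Choice of jacobian_rat_points by <:].
HB.instance Definition _ :=
  [SubChoice_isSubZmodule of jacobian_rat_points by <:].

End Curve.

(** [a : b : c : u : v] is a rational point of S. *)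
Definition in_S (a b c u v : rat) : Prop :=
  a ^+ 2 + b ^+ 2 + c ^+ 2 = u ^+ 2 + v ^+ 2 /\
  a ^+ 4 + b ^+ 4 + c ^+ 4 = u ^+ 4 + v ^+ 4.

Definition in_S_open (a b c u v : rat) : Prop :=
  [/\ in_S a b c u v,
      [&& a != 0, b != 0, c != 0, u != 0 & v != 0] &
      uniq [:: a ^+ 2; b ^+ 2; c ^+ 2; u ^+ 2; v ^+ 2]].

Definition X_sextic (a b c u v : rat) : {poly rat} :=
  'X * ('X - (a ^+ 2)%:P) * ('X - (b ^+ 2)%:P) * ('X - (c ^+ 2)%:P)
     * ('X - (u ^+ 2)%:P) * ('X - (v ^+ 2)%:P).

(* Main.v *)
Require Import Defs.
From HB Require Import structures.
From mathcomp Require Import all_boot all_order all_algebra all_field.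
From mathcomp Require Import ring_quotient qpoly boolp ring.
From mathcomp.multinomials Require Import freeg.

(** Write [A = a^2], ..., [V = v^2], [g = x (x - U) (x - V)] and [N = (abc)^2].
    The two equations of S say that [A, B, C] and [0, U, V] have the same first
    two elementary symmetric functions, so that [(x - A)(x - B)(x - C) = g - N]
    and the curve is [y^2 = g (g - N) = (g - N/2)^2 - N^2/4].  Hence the function
    [y - (g - N/2)] has its divisor supported at infinity, and the difference of
    the two points at infinity has order 3.

    The six Weierstrass points are rational and give a full rational 2-torsion
    group.  With [h = (x - U)(x - V)], the 2-torsion class of
    [(U,0) + (V,0) - K], [K] the divisor at infinity, is the double of a rational
    class: [h] takes the square values [(uv)^2, (bc)^2, (ca)^2, (ab)^2] at the
    other roots [0, A, B, C], and solving for a linear [M] and a quadratic [Q]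
    with [Q(r) = +- sqrt(h(r)) M(r)] at these roots yields
    [h M^2 - Q^2 = k^2 x (x - A)(x - B)(x - C)] with [k] rational, so that the
    curve [y = h M / k] is tangent to X over the two roots of [Q].  The resulting
    class of order 4, the class of order 3 and three more 2-torsion classes
    generate the required subgroup.

    Independence rests on one fact: a function whose only poles are at infinity,
    of order at most 2, is a polynomial in [x], and therefore has even order at
    every Weierstrass point and no zero at infinity. *)

Set Implicit Arguments.
Unset Strict Implicit.
Unset Printing Implicit Defensive.
Import GRing.Theory Num.Theory.
Local Open Scope ring_scope.
Local Notation tofrac := (@FracField.tofrac _).

Lemma linear_poly_eq0 (R : nzRingType) (r s : R) :
  r%:P + s *: 'X = 0 -> r = 0 /\ s = 0.
Proof.
move/polyP => e; split.
  by have := e 0; rewrite coefD coefC coefZ coefX mulr0 addr0 coef0.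
by have := e 1; rewrite coefD coefC coefZ coefX mulr1 add0r coef0.
Qed.

(** * The function field *)

Section FunctionField.

Variable f : {poly rat}.
Local Notation fbar := (map_poly ratr f : {poly algC}).
Local Notation rf := (@ff_of_ratfun f).
Local Notation y := (ff_y f).

Lemma modulusE : mk_monic ('X^2 - (tofrac fbar)%:P) = 'X^2 - (tofrac fbar)%:P.
Proof. by rewrite /mk_monic size_XnsubC // monicXnsubC. Qed.

Lemma ff_y2 : y ^+ 2 = rf (tofrac fbar).
Proof.
set c := (tofrac fbar)%:P; rewrite /ff_y.
have -> : in_qpoly ('X^2 - c) 'X ^+ 2 = in_qpoly ('X^2 - c) ('X^2 - c + c).
  by rewrite subrK rmorphXn.
rewrite in_qpolyD (_ : in_qpoly _ ( _ - _) = 0) ?add0r.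
  apply: val_inj; rewrite /= modulusE Pdiv.Ring.rmodp_small //.
  by rewrite size_XnsubC // (leq_ltn_trans (size_polyC_leq1 _)).
by apply: val_inj; rewrite /= modulusE Pdiv.RingMonic.rmodpp // monicXnsubC.
Qed.

(** The right-hand side has degree below that of the monic modulus, so reduction leaves it
    unchanged. This gives [1, y] as a basis over the rational functions. *)
Lemma ff_valE (r s : {fraction {poly algC}}) :
  (rf r + rf s * y : {poly _}) = r%:P + s *: 'X.
Proof.
have yE : (y : {poly _}) = 'X by apply: qpolyXE; rewrite ?monicXnsubC ?size_XnsubC.
rewrite poly_of_qpolyD.
have -> : (rf s * y : {poly _}) = Pdiv.Ring.rmodp (s%:P * 'X) (mk_monic ('X^2 -
  (tofrac fbar)%:P)).
  by rewrite -[in X in Pdiv.Ring.rmodp X _]yE.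
rewrite [in Pdiv.Ring.rmodp _ _]modulusE Pdiv.Ring.rmodp_small ?mul_polyC //
  size_XnsubC //.
by rewrite (leq_ltn_trans (size_scale_leq _ _)) // size_polyX.
Qed.

Lemma ff_decomp h : exists r s, h = rf r + rf s * y.
Proof.
exists (val h)`_0, (val h)`_1; apply: val_inj; rewrite [RHS]ff_valE.
apply/polyP => i; rewrite coefD coefC coefZ coefX.
have sh : (size (val h) <= 2)%N.
  by apply: leq_trans (size_npoly h) _; rewrite modulusE size_XnsubC.
case: i => [|[|i]] /=; rewrite ?mulr0 ?mulr1 ?addr0 ?add0r //.
by apply: nth_default; apply: leq_trans sh _.
Qed.

Lemma ff_free r s : rf r + rf s * y = 0 -> r = 0 /\ s = 0.
Proof.
move=> e; have e1 : r%:P + s *: 'X = 0 :> {poly {fraction {poly algC}}}.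
  by rewrite -ff_valE e; reflexivity.
exact: linear_poly_eq0 e1.
Qed.

End FunctionField.

(** * Regular functions and orders *)

(** The reciprocal polynomial [t^n a(1/t)] for [a] of degree at most [n]; it carries polynomials in
    [x] to the chart at infinity. *)
Definition rev_poly (R : nzRingType) n (a : {poly R}) := \poly_(i < n.+1) a`_(n - i).

Lemma rev_poly_horner0 (R : nzRingType) n (a : {poly R}) : (rev_poly n a).[0] = a`_n.
Proof. by rewrite horner_coef0 coef_poly subn0. Qed.

Lemma rev_polyK (R : nzRingType) n (a : {poly R}) :
  (size a <= n.+1)%N -> rev_poly n (rev_poly n a) = a.
Proof.
move=> sa; apply/polyP => i; rewrite !coef_poly; case: ltnP => [|ni].
  by rewrite !ltnS leq_subr => ni; rewrite subKn.
by rewrite nth_default // (leq_trans sa).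
Qed.

(** In [{poly {poly R}}] the outer variable stands for the first coordinate and the inner one for
    the second: [a ^:P] involves only the first, and ['X%:P] is the second. *)
Lemma horner2_X (R : comNzRingType) (a : {poly R}) (p0 q0 : R) : (a ^:P).[p0,q0]
  = a.[p0].
Proof. by rewrite horner_map hornerC. Qed.

Lemma horner2_Y (R : comNzRingType) (p0 q0 : R) : ('X%:P : {poly {poly R}}).[p0,q0]
  = q0.
Proof. by rewrite hornerC hornerX. Qed.

Definition horner2E := (horner2_X, horner2_Y).

Lemma poly2_mod_sqr (R : comNzRingType) (F : {poly R}) (Z : {poly {poly R}}) :
  exists a b W, Z = a ^:P + b ^:P * 'X%:P + W * ('X%:P ^+2 - F ^:P).
Proof.
elim/poly_ind: Z => [|Z c [a [b [W ->]]]].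
  by exists 0, 0, 0; rewrite !rmorph0 !mul0r !addr0.
have [a1 [b1 [W1 ->]]] : exists a b W,
    c%:P = a ^:P + b ^:P * 'X%:P + W * ('X%:P ^+2 - F ^:P) :> {poly {poly R}}.
  elim/poly_ind: c => [|c k [a1 [b1 [W1 e]]]].
    by exists 0, 0, 0; rewrite !rmorph0 !mul0r !addr0.
  exists (b1 * F + k%:P), a1, (W1 * 'X%:P + b1^:P).
  by rewrite !rmorphD !rmorphM /= e map_polyC /=; ring.
exists (a * 'X + a1), (b * 'X + b1), (W * 'X + W1).
by rewrite !rmorphD !rmorphM /= map_polyX; ring.
Qed.

(** The hyperelliptic involution on bivariate polynomials. *)
Definition negY (R : comNzRingType) (A : {poly {poly R}}) :=
  map_poly (comp_poly (- 'X)) A.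

Lemma negY_horner (R : comNzRingType) (A : {poly {poly R}}) p0 q0 : (negY A).[p0,q0]
  = A.[p0,-q0].
Proof.
rewrite /negY; elim/poly_ind: A => [|A c IH]; first by rewrite rmorph0 !horner0.
rewrite rmorphD rmorphM /= map_polyX map_polyC /= !hornerE IH horner_comp.
by rewrite !hornerE.
Qed.

Lemma frac_coprime (C : fieldType) (r : {fraction {poly C}}) :
  exists n d : {poly C}, [/\ d != 0, coprimep n d & r = tofrac n / tofrac d].
Proof.
have [n [d [d0 e]]] : exists n d : {poly C}, d != 0 /\ r = tofrac n / tofrac d.
  elim/quotW: r => -[[n d] /= d0]; exists n, d; split=> //.
  have dF : tofrac d != 0 by rewrite tofrac_eq0.
  apply: (mulIf dF); rewrite divfK //; unlock FracField.tofrac.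
  rewrite -[LHS]FracField.pi_mul; apply/eqmodP => /=.
  by rewrite FracField.equivfE /= !numden_Ratio ?mulr1 ?oner_neq0 // mulrC.
have g0 : gcdp n d != 0 by rewrite gcdp_eq0 negb_and d0 orbT.
exists (n %/ gcdp n d), (d %/ gcdp n d); split.
- by rewrite dvdp_div_eq0 ?dvdp_gcdr.
- by rewrite coprimep_div_gcd // d0 orbT.
rewrite e; have en := divpK (dvdp_gcdl n d); have ed := divpK (dvdp_gcdr n d).
rewrite -[in LHS]en -[X in _ / tofrac X]ed !rmorphM /=.
by rewrite invfM mulrACA divff ?mulr1 // tofrac_eq0.
Qed.

Lemma unit_mulI (K : comUnitRingType) (u a b : K) :
  u \is a GRing.unit -> a * u = b * u -> a = b.
Proof. by move=> uu; apply: mulIr. Qed.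

Section Ring.

(* [K] plays the role of C(x)[y] / (y^2 - F), which enters only through the
   hypotheses below; [rf] embeds C(x). *)
Variables (C : numClosedFieldType) (K : comUnitRingType).
Variables (rf : {rmorphism {fraction {poly C}} -> K}) (y : K) (F : {poly C}).

Definition pol (a : {poly C}) : K := rf (tofrac a).
Definition cst (c : C) : K := rf (tofrac c%:P).
Local Notation x := (pol 'X).

Hypothesis decomp : forall h, exists r s, h = rf r + rf s * y.
Hypothesis free : forall r s, rf r + rf s * y = 0 -> r = 0 /\ s = 0.
Hypothesis y2 : y ^+ 2 = pol F.
Hypothesis monF : F \is monic.
Hypothesis sizeF : size F = 7%N.
Hypothesis sepF : forall z, root F z -> exists2 G, F = ('X - z%:P) * G & G.[z] != 0.

Lemma pol_is_zmod_morphism : zmod_morphism pol.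
Proof. by move=> a b; rewrite /pol !rmorphB. Qed.

Lemma pol_is_monoid_morphism : monoid_morphism pol.
Proof. by split=> [|a b]; rewrite /pol ?rmorph1 ?rmorphM. Qed.
HB.instance Definition _ := GRing.isZmodMorphism.Build _ _ pol pol_is_zmod_morphism.
HB.instance Definition _ := GRing.isMonoidMorphism.Build _ _ pol pol_is_monoid_morphism.

Lemma polB a b : pol (a - b) = pol a - pol b.
Proof. exact: rmorphB. Qed.

Lemma polM a b : pol (a * b) = pol a * pol b.
Proof. exact: rmorphM. Qed.

Lemma polX a n : pol (a ^+ n) = pol a ^+ n.
Proof. exact: rmorphXn. Qed.

Lemma cst_is_zmod_morphism : zmod_morphism cst.
Proof. by move=> a b; rewrite /cst !rmorphB. Qed.

Lemma cst_is_monoid_morphism : monoid_morphism cst.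
Proof. by split=> [|a b]; rewrite /cst ?rmorph1 ?rmorphM. Qed.
HB.instance Definition _ := GRing.isZmodMorphism.Build _ _ cst cst_is_zmod_morphism.
HB.instance Definition _ := GRing.isMonoidMorphism.Build _ _ cst cst_is_monoid_morphism.

Lemma rf_unit r : r != 0 -> rf r \is a GRing.unit.
Proof. by move=> r0; apply: rmorph_unit; rewrite unitfE. Qed.

Lemma pol_unit a : a != 0 -> pol a \is a GRing.unit.
Proof. by move=> a0; apply: rf_unit; rewrite tofrac_eq0. Qed.

Lemma cst_horner_x a : (map_poly cst a).[x] = pol a.
Proof.
elim/poly_ind: a => [|a c IH]; first by rewrite !rmorph0 horner0.
by rewrite !rmorphD !rmorphM /= map_polyX map_polyC /= !hornerE IH.
Qed.

Lemma unit_x : x \is a GRing.unit.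
Proof. by rewrite pol_unit // polyX_eq0. Qed.
Hint Resolve unit_x : core.

Lemma rev_poly_horner n (a : {poly C}) : (size a <= n.+1)%N ->
  (map_poly cst (rev_poly n a)).[x^-1] = pol a / x ^+ n.
Proof.
move=> sa.
have aE : a = \poly_(i < n.+1) a`_i.
  apply/polyP => i; rewrite coef_poly; case: ltnP => // ni.
  by rewrite nth_default // (leq_trans sa).
rewrite [in RHS]aE -[pol (\poly_(i < _) _)]cst_horner_x.
have mE (b : nat -> C) z : (map_poly cst (\poly_(i < n.+1) b i)).[z] =
    \sum_(i < n.+1) cst (b i) * z ^+ i.
  rewrite poly_def rmorph_sum horner_sum; apply: eq_bigr => i _.
  by rewrite /= map_polyZ map_polyXn !hornerE.
rewrite /rev_poly !mE (reindex_inj rev_ord_inj) /=.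
rewrite mulr_suml; apply: eq_bigr => i _.
have ni : (i <= n)%N by rewrite -ltnS.
rewrite subSS subKn // -mulrA; congr (_ * _).
apply: (mulIr (unitrX n unit_x)); rewrite mulrVK ?unitrX //.
by rewrite -[in X in _ * x ^+ X](subnK ni) exprD exprVn mulKr ?unitrX.
Qed.

(** * Evaluation in the function field, charts and regularity *)

Definition ev (p q : K) (A : {poly {poly C}}) : K :=
  (map_poly (map_poly cst) A).[p, q].

Lemma ev_is_zmod_morphism p q : zmod_morphism (ev p q).
Proof. by move=> A B; rewrite /ev rmorphB !hornerE. Qed.

Lemma ev_is_monoid_morphism p q : monoid_morphism (ev p q).
Proof. by split=> [|A B]; rewrite /ev ?rmorph1 ?rmorphM !hornerE. Qed.
HB.instance Definition _ p q := GRing.isZmodMorphism.Build _ _ (ev p q)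
  (ev_is_zmod_morphism p q).
HB.instance Definition _ p q := GRing.isMonoidMorphism.Build _ _ (ev p q)
  (ev_is_monoid_morphism p q).

Lemma evB p q A B : ev p q (A - B) = ev p q A - ev p q B.
Proof. exact: rmorphB. Qed.

Lemma evD p q A B : ev p q (A + B) = ev p q A + ev p q B.
Proof. exact: rmorphD. Qed.

Lemma evM p q A B : ev p q (A * B) = ev p q A * ev p q B.
Proof. exact: rmorphM. Qed.

Lemma evC p q c : ev p q c%:P = (map_poly cst c).[q].
Proof. by rewrite /ev map_polyC /= hornerC. Qed.

Lemma evX p q : ev p q 'X = p.
Proof. by rewrite /ev map_polyX !hornerE. Qed.

Lemma evY p q : ev p q ('X%:P) = q.
Proof. by rewrite evC map_polyX hornerX. Qed.

Lemma evP p q (a : {poly C}) : ev p q (a ^:P) = (map_poly cst a).[p].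
Proof.
elim/poly_ind: a => [|a c IH]; first by rewrite !rmorph0 horner0.
by rewrite !rmorphD !rmorphM /= !map_polyX !map_polyC /= IH evX evC map_polyC !hornerE.
Qed.

Lemma ev_x (a : {poly C}) q : ev x q (a ^:P) = pol a.
Proof. by rewrite evP cst_horner_x. Qed.

(* [p] and [q] are the coordinate functions of an affine chart q^2 = G(p), whose
   coordinate ring embeds in [K] by [chart_inj]. *)
Record chart (p q : K) (G : {poly C}) : Prop := Chart {
  chart_eq : q ^+ 2 = (map_poly cst G).[p];
  chart_inj : forall a b, (map_poly cst a).[p] + (map_poly cst b).[p] * q = 0 ->
    a = 0 /\ b = 0
}.

(** Reduced modulo [Y^2 - G(X)], [Z] becomes [a(X) + b(X) Y], and [chart_inj] kills [a] and [b]. An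
    identity in [K] can thus be evaluated at a point of the curve. *)
Lemma chart_ev0 p q G p0 q0 Z : chart p q G -> q0 ^+ 2 = G.[p0] ->
  ev p q Z = 0 -> Z.[p0, q0] = 0.
Proof.
move=> [e i] e0; have [a [b [W ->]]] := poly2_mod_sqr G Z.
rewrite !rmorphD /= !rmorphM !rmorphB /= !rmorphXn /= !evP !evY e subrr mulr0 addr0.
move/i => [-> ->]; rewrite !rmorph0 mul0r !add0r !hornerM !hornerD !hornerN !horner_exp.
by rewrite !horner2E e0 subrr mulr0.
Qed.

Lemma chart_affine : chart x y F.
Proof.
split=> [|a b]; first by rewrite cst_horner_x.
rewrite !cst_horner_x => /free[/eqP + /eqP]; rewrite !tofrac_eq0.
by move=> /eqP-> /eqP->.
Qed.

Lemma chart_infinity : chart (x^-1) (y / x ^+ 3) (rev_poly 6 F).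
Proof.
split=> [|a b].
  rewrite rev_poly_horner ?sizeF // exprMn y2; congr (_ * _).
  by rewrite exprVn -exprM.
(* With a common degree bound, the relation at infinity is, up to the factor [x ^+ (n + 3)], one
   between polynomials in [x]; the 3 comes from [y / x ^+ 3]. *)
pose n := maxn (size a) (size b).
have sa : (size a <= n.+1)%N by rewrite leqW // leq_maxl.
have sb : (size b <= n.+1)%N by rewrite leqW // leq_maxr.
rewrite -(rev_polyK sa) -(rev_polyK sb) !rev_poly_horner ?size_poly // => e.
have {e} : pol (rev_poly n a * 'X^3) + pol (rev_poly n b) * y = 0.
  apply: (mulIr (_ : (x^-1) ^+ (n + 3) \is a GRing.unit)).
    by rewrite unitrX // unitrV.
  have xK : x * x^-1 = 1 by rewrite divrr.
  rewrite mul0r -[RHS]e rmorphM rmorphXn /= -!exprVn.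
  by rewrite -[in RHS](mulr1 (pol (rev_poly n a))) -(expr1n _ 3) -xK exprD;
    move: (x^-1 ^+ n) => u; ring.
move/free => -[/eqP + /eqP]; rewrite !tofrac_eq0 mulf_eq0 expf_eq0 polyX_eq0 orbF.
by move=> /eqP-> /eqP->; rewrite /rev_poly; split; apply/polyP => i;
  rewrite coef_poly !coef0 if_same.
Qed.

Definition regular_at p q p0 q0 h := exists A B, B.[p0, q0]
  != 0 /\ h * ev p q B = ev p q A.

Lemma regular_ev p q p0 q0 A : regular_at p q p0 q0 (ev p q A).
Proof. by exists A, 1; rewrite rmorph1 mulr1 hornerC hornerC oner_eq0. Qed.

Lemma regularM p q p0 q0 g h : regular_at p q p0 q0 g -> regular_at p q p0 q0 h ->
  regular_at p q p0 q0 (g * h).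
Proof.
move=> [A [B [B0 e]]] [A' [B' [B0' e']]]; exists (A * A'), (B * B').
by rewrite !hornerM mulf_neq0 // !rmorphM /= mulrACA e e'.
Qed.

Lemma regularD p q p0 q0 g h : regular_at p q p0 q0 g -> regular_at p q p0 q0 h ->
  regular_at p q p0 q0 (g + h).
Proof.
move=> [A [B [B0 e]]] [A' [B' [B0' e']]]; exists (A * B' + A' * B), (B * B').
by rewrite !hornerM mulf_neq0 // !rmorphD !rmorphM /= -e -e'; split=> //; ring.
Qed.

Lemma regularX p q p0 q0 g n : regular_at p q p0 q0 g -> regular_at p q p0 q0 (g ^+ n).
Proof.
move=> rg; elim: n => [|n IH]; last by rewrite exprS; apply: regularM.
by rewrite expr0 -(rmorph1 (ev p q)); apply: regular_ev.
Qed.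

(* The graph of the hyperelliptic involution. *)
Definition conjugates g g' := exists r s, g = rf r + rf s * y /\ g' = rf r - rf s * y.

Lemma conjugates_uniq g g1 g2 : conjugates g g1 -> conjugates g g2 -> g1 = g2.
Proof.
move=> [r [s [-> ->]]] [r' [s' [e ->]]].
have [] : r - r' = 0 /\ s - s' = 0.
  apply: free; rewrite !rmorphB mulrBl addrACA -opprD e subrr //.
by move=> /eqP + /eqP; rewrite !subr_eq0 => /eqP-> /eqP->.
Qed.

Lemma conjugatesD g g' h h' : conjugates g g' -> conjugates h h' ->
  conjugates (g + h) (g' + h').
Proof.
move=> [r [s [-> ->]]] [r' [s' [-> ->]]]; exists (r + r'), (s + s').
by rewrite !rmorphD; split; ring.
Qed.

Lemma conjugatesM g g' h h' : conjugates g g' -> conjugates h h' ->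
  conjugates (g * h) (g' * h').
Proof.
move=> [r [s [-> ->]]] [r' [s' [-> ->]]].
exists (r * r' + s * s' * tofrac F), (r * s' + r' * s).
by rewrite !rmorphD !rmorphM -/(pol F) -y2; split; ring.
Qed.

Lemma conjugates_rf r : conjugates (rf r) (rf r).
Proof. by exists r, 0; rewrite rmorph0 mul0r addr0 subr0. Qed.

Lemma conjugates_y s : conjugates (rf s * y) (- (rf s * y)).
Proof. by exists 0, s; rewrite rmorph0 !add0r. Qed.

Lemma conjugates_ev r s A : conjugates (ev (rf r) (rf s * y) A) (ev (rf r) (rf s * y)
  (negY A)).
Proof.
have c0 : conjugates 0 0 by rewrite -(rmorph0 rf); apply: conjugates_rf.
elim/poly_ind: A => [|A c IH]; first by rewrite /negY !rmorph0.
rewrite /negY !rmorphD !rmorphM /= !map_polyX map_polyC /= !evX !evC.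
apply: conjugatesD; first by apply: conjugatesM => //; apply: conjugates_rf.
elim/poly_ind: c {A IH} => [|c k IH]; first by rewrite !rmorph0 !horner0.
rewrite !rmorphD !rmorphM /= comp_polyX comp_polyC map_polyX rmorphN /= map_polyX
  map_polyC /=.
rewrite !(hornerD, hornerM, hornerN, hornerX, hornerC).
by apply: conjugatesD; [apply: conjugatesM => //;
  apply: conjugates_y | apply: conjugates_rf].
Qed.

Lemma regular_conj r s p0 q0 g g' : conjugates g g' ->
  regular_at (rf r) (rf s * y) p0 (- q0) g -> regular_at (rf r) (rf s * y) p0 q0 g'.
Proof.
move=> cg [A [B [B0 e]]]; exists (negY A), (negY B); rewrite negY_horner; split=> //.
apply: (conjugates_uniq (conjugatesM cg (conjugates_ev r s B))); rewrite e;
  exact: conjugates_ev.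
Qed.

(** Regularity at the conjugate point makes the conjugate function regular here, hence also half the
    trace and the norm. Coordinates [rf r] and [rf s * y] cover both charts at once. *)
Lemma regular_trace_norm r s p0 q0 a b :
    (forall q, q ^+ 2 = q0 ^+ 2 -> regular_at (rf r) (rf s * y) p0 q (rf a + rf b * y))
      ->
  regular_at (rf r) (rf s * y) p0 q0 (rf a) /\
  regular_at (rf r) (rf s * y) p0 q0 (rf (a ^+ 2 - b ^+ 2 * tofrac F)).
Proof.
move=> rg; have rg1 := rg q0 erefl.
have rg2 : regular_at (rf r) (rf s * y) p0 q0 (rf a - rf b * y).
  by apply: (@regular_conj r s _ _ (rf a + rf b * y)); [exists a, b | apply: rg;
    rewrite sqrrN].
split.
  have -> : rf a = ev (rf r) (rf s * y) (2%:R^-1)%:P%:P * ((rf a + rf b * y) + (rf a -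
    rf b * y)).
    rewrite evC map_polyC hornerC /=.
    have h2 : cst 2%:R^-1 * 2%:R = 1.
      by rewrite -(rmorph_nat cst 2) -rmorphM mulVf ?pnatr_eq0 // rmorph1.
    by rewrite -[LHS]mul1r -h2; ring.
  by apply: regularM; [apply: regular_ev | apply: regularD].
have -> : rf (a ^+ 2 - b ^+ 2 * tofrac F) = (rf a + rf b * y) * (rf a - rf b * y).
  by rewrite rmorphB [rf (b ^+ 2 * _)]rmorphM !rmorphXn -/(pol F) -y2 /=; ring.
exact: regularM.
Qed.

(** * Functions without affine poles *)

Lemma tofracZV (c : C) (n : {poly C}) : tofrac (c^-1 *: n) = tofrac n / tofrac c%:P.
Proof. by rewrite -mul_polyC tofracM mulrC -(fmorphV (tofrac \o polyC)). Qed.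

(** Regularity gives [n B = d A] with [B] nonzero at the point, so a root of [d] there would also be
    a root of [n]. *)
Lemma regular_frac_denom n d x0 y0 : y0 ^+ 2 = F.[x0] -> d != 0 -> coprimep n d ->
  regular_at x y x0 y0 (rf (tofrac n / tofrac d)) -> d.[x0] != 0.
Proof.
move=> e0 dn0 cop [A [B [B0 e]]]; apply/negP => d0.
have : ev x y (n^:P * B - d^:P * A) = 0.
  have dE : pol d * rf (tofrac n / tofrac d) = pol n.
    by rewrite /pol -(rmorphM rf) mulrC divfK ?tofrac_eq0.
  by rewrite evB !evM !ev_x -e mulrA dE subrr.
move/(chart_ev0 chart_affine e0); rewrite hornerD hornerN !hornerM hornerD hornerN
  !hornerM.
rewrite !horner2E (eqP d0) mul0r subr0 => /eqP; rewrite mulf_eq0 (negPf B0) orbF => n0.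
by have := coprimep_root cop n0; rewrite d0.
Qed.

Lemma poly_of_regular r : (forall x0 y0, y0 ^+ 2 = F.[x0] ->
  regular_at x y x0 y0 (rf r)) ->
  exists a, r = tofrac a.
Proof.
have [n [d [d0 cop ->]]] := frac_coprime r => rg.
have sd : size d == 1%N.
  apply/negPn/closed_rootP => -[x0 /rootP dx0].
  (* Every abscissa carries a point of the curve, so [regular_frac_denom] applies at any root of
     [d]. *)
  have e0 := sqrtCK F.[x0].
  by have := regular_frac_denom e0 d0 cop (rg _ _ e0); rewrite dx0 eqxx.
have [c c0 ->] := size_poly1P _ sd.
by exists (c^-1 *: n); rewrite tofracZV.
Qed.

(* The trace and the norm of [g] lie in C(x) and are regular, hence polynomials;
   the coefficient of [y] then has no denominator because F is squarefree. *)
Lemma regular_affine g : (forall x0 y0, y0 ^+ 2 = F.[x0] -> regular_at x y x0 y0 g) ->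
  exists a b, g = pol a + pol b * y.
Proof.
have [r [s ->]] := decomp g => rg.
have tr x0 y0 : y0 ^+ 2 = F.[x0] -> regular_at x y x0 y0 (rf r) /\
    regular_at x y x0 y0 (rf (r ^+ 2 - s ^+ 2 * tofrac F)).
  move=> e0; have := @regular_trace_norm (tofrac 'X) 1 x0 y0 r s; rewrite rmorph1 mul1r.
  by apply=> q eq; apply: rg; rewrite eq.
have [a ra] := poly_of_regular (fun x0 y0 e => (tr x0 y0 e).1).
have [c rc] := poly_of_regular (fun x0 y0 e => (tr x0 y0 e).2).
have [n [d [d0 cop sE]]] := frac_coprime s.
have e : n ^+ 2 * F = (a ^+ 2 - c) * d ^+ 2.
  apply/eqP; rewrite -tofrac_eq !tofracM tofracB !tofracXn -ra -rc opprB addrC subrK sE.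
  by rewrite [eqbRHS]mulrAC -exprMn divfK ?tofrac_eq0.
suff sd : size d == 1%N.
  have [k k0 dE] := size_poly1P _ sd; exists a, (k^-1 *: n).
  by rewrite ra sE /pol tofracZV -dE.
apply/negPn/closed_rootP => -[x0 dx0].
have n0 : n.[x0] != 0 by apply: (coprimep_root _ dx0); rewrite coprimep_sym.
have Fx0 : root F x0.
  have := congr1 (horner^~ x0) e; rewrite !hornerM (rootP dx0) !mulr0.
  by move/eqP; rewrite !mulf_eq0 !(negPf n0).
have [G FE G0] := sepF Fx0; have /factor_theorem[d1 dE] := dx0.
(* The root [x0] of [F] is simple while [d ^+ 2] vanishes there twice: after one factor is
   cancelled, only the right-hand side still vanishes at [x0]. *)
have : n ^+ 2 * G = (a ^+ 2 - c) * d1 * d.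
  have X0 : 'X - x0%:P != 0 :> {poly C} by rewrite polyXsubC_eq0.
  apply: (mulfI X0); rewrite mulrCA -FE e dE; ring.
move/(congr1 (horner^~ x0)); rewrite !hornerM (rootP dx0) mulr0 => /eqP.
by rewrite !mulf_eq0 (negPf n0) (negPf G0).
Qed.

Lemma sqr_rev_poly0 s : s ^+ 2 = 1 -> s ^+ 2 = (rev_poly 6 F).[0].
Proof.
move=> ->; rewrite rev_poly_horner0; move: (monicP monF).
by rewrite lead_coefE sizeF => ->.
Qed.

(** If the degree exceeded [m], multiplying by a power of the parameter [1/x] would make the
    reversed polynomial vanish at 0, where its value is the leading coefficient of [a]. *)
Lemma size_regular_infinity (a : {poly C}) m s : s ^+ 2 = 1 ->
  regular_at x^-1 (y / x ^+ 3) 0 s (pol a / x ^+ m) -> (size a <= m.+1)%N.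
Proof.
move=> s1 [A [B [B0 e]]]; rewrite leqNgt; apply/negP => ma.
have [d da] : exists d, size a = (d + m).+2.
  by exists (size a - m.+2)%N; rewrite -addnS -addnS subnK.
have : ev x^-1 (y / x ^+ 3) ((rev_poly (d + m).+1 a)^:P * B - 'X ^+ d.+1 * A) = 0.
  rewrite evB !evM rmorphXn /= evX evP rev_poly_horner ?da // -e.
  rewrite -addSn exprD invrM ?unitrX // exprVn.
  by move: (x ^- m) (x ^- d.+1) => u v; ring.
move/(chart_ev0 chart_infinity (sqr_rev_poly0 s1));
  rewrite hornerD hornerN !hornerM hornerD hornerN !hornerM.
rewrite !horner2E rev_poly_horner0 !horner_exp !hornerX hornerC expr0n mul0r subr0 =>
  /eqP.
rewrite mulf_eq0 (negPf B0) orbF.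
have -> : (d + m).+1 = (size a).-1 by rewrite da.
by rewrite -lead_coefE lead_coef_eq0 -size_poly_eq0 da.
Qed.

(* A nonzero [b] would force a pole of order at least 3 in [pol b * y]; the norm
   detects it, as [b^2 F] has degree at least 6. *)
Lemma global_poly g : (forall x0 y0, y0 ^+ 2 = F.[x0] -> regular_at x y x0 y0 g) ->
    (forall s, s ^+ 2 = 1 -> regular_at x^-1 (y / x ^+ 3) 0 s (g / x ^+ 2)) ->
  exists a, g = pol a.
Proof.
move=> /regular_affine[a [b ->]] rg; exists a.
have tE : x^-1 = rf (tofrac 'X)^-1.
  by rewrite rmorphV // unitfE tofrac_eq0 polyX_eq0.
have tn n : x ^- n = rf (tofrac 'X ^- n) by rewrite -exprVn tE -rmorphXn exprVn.
have quo c n : rf (tofrac c / tofrac 'X ^+ n) = pol c / x ^+ n.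
  by rewrite (rmorphM rf) /= -tn.
have gE : (pol a + pol b * y) / x ^+ 2 =
    rf (tofrac a / tofrac 'X ^+ 2) + rf (tofrac b / tofrac 'X ^+ 2) * y.
  by rewrite !quo mulrDl [_ * y * _]mulrAC.
have yE : y / x ^+ 3 = rf (tofrac 'X ^- 3) * y by rewrite -tn mulrC.
have [ra rb] : regular_at x^-1 (y / x ^+ 3) 0 1 (pol a / x ^+ 2) /\
    regular_at x^-1 (y / x ^+ 3) 0 1 (pol (a ^+ 2 - b ^+ 2 * F) / x ^+ 4).
  rewrite -!quo tofracB [tofrac (_ * F)]tofracM !tofracXn.
  rewrite (_ : (_ - _) / _ = (tofrac a / tofrac 'X ^+ 2) ^+ 2 -
    (tofrac b / tofrac 'X ^+ 2) ^+ 2 * tofrac F).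
    by rewrite yE tE; apply: regular_trace_norm => q; rewrite -gE expr1n -tE -yE;
      apply: rg.
  by rewrite !exprMn -!exprVn -!exprM mulrBl [_ * tofrac F * _]mulrAC.
have sa := size_regular_infinity (expr1n _ 2) ra.
have sb := size_regular_infinity (expr1n _ 2) rb.
suff -> : b = 0 by rewrite rmorph0 mul0r addr0.
apply/eqP/negPn/negP => b0.
have : (size (b ^+ 2 * F)%R <= 5)%N.
  have -> : b ^+ 2 * F = a ^+ 2 - (a ^+ 2 - b ^+ 2 * F) by ring.
  apply: leq_trans (size_polyD _ _) _; rewrite size_polyN geq_max sb andbT.
  apply: leq_trans (size_poly_exp_leq _ _) _.
  by case: (size a) sa => [|[|[|[]]]].
by rewrite size_Mmonic ?expf_neq0 // sizeF addnS /= leqNgt (leq_trans _ (leq_addl _ _)).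
Qed.

(** * Local units and orders of functions *)

Definition unit_at p q p0 q0 h := exists A B : {poly {poly C}},
  [/\ A.[p0, q0] != 0, B.[p0, q0] != 0 & h * ev p q B = ev p q A].

Lemma unit_at_regular p q p0 q0 h : unit_at p q p0 q0 h -> regular_at p q p0 q0 h.
Proof. by move=> [A [B [_ B0 e]]]; exists A, B. Qed.

Lemma unit_at_ev p q p0 q0 A : A.[p0, q0] != 0 -> unit_at p q p0 q0 (ev p q A).
Proof. by move=> A0; exists A, 1; rewrite rmorph1 mulr1 !hornerC oner_eq0. Qed.

(* [y] is a local parameter at a Weierstrass point, where a function of [x] has
   even order. *)
Lemma no_odd_zero a z v : a != 0 -> root F z -> unit_at x y z 0 v -> pol a <> y * v.
Proof.
move=> a0 Fz [A [B [A0 B0 e]]] av.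
have [G FE G0] := sepF Fz.
have e0 : 0 ^+ 2 = F.[z] by rewrite (rootP Fz) expr0n.
have e1 : pol a * ev x y B = y * ev x y A by rewrite av -mulrA e.
have az : root a z.
  have : ev x y (a^:P * B - 'X%:P * A) = 0.
    by rewrite evB !evM ev_x evY e1 subrr.
  move/(chart_ev0 chart_affine e0); rewrite hornerD hornerN !hornerM hornerD hornerN
    !hornerM.
  by rewrite !horner2E mul0r subr0 => /eqP; rewrite mulf_eq0 (negPf B0) orbF.
have /factor_theorem[b aE] := az.
(* Now [a = b (X - z)] and [y^2 = (X - z) G]; cancelling [X - z] in [a B y = y^2 A] leaves an
   identity that fails at [(z, 0)], where [G A] is nonzero. *)
have : ev x y (b^:P * B * 'X%:P - G^:P * A) = 0.
  have uz : pol ('X - z%:P) \is a GRing.unit by rewrite pol_unit // polyXsubC_eq0.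
  have aX : pol a = pol b * pol ('X - z%:P) by rewrite aE rmorphM.
  have yX : y ^+ 2 = pol ('X - z%:P) * pol G by rewrite y2 FE rmorphM.
  move: (pol ('X - z%:P)) uz aX yX => X uz aX yX.
  apply: (unit_mulI uz); rewrite mul0r evB !evM /= !ev_x evY.
  transitivity (y * (pol a * ev x y B) - y ^+ 2 * ev x y A).
    by rewrite aX yX; ring.
  by rewrite e1; ring.
move/(chart_ev0 chart_affine e0); rewrite hornerD hornerN !hornerM hornerD hornerN
  !hornerM.
rewrite !horner2E mulr0 sub0r => /eqP.
by rewrite oppr_eq0 mulf_eq0 (negPf A0) (negPf G0).
Qed.

(** Divided by [x] to its degree, a polynomial takes its leading coefficient as value at infinity,
    so a zero there would kill that coefficient. *)
Lemma no_zero_infinity a s v : a != 0 -> s ^+ 2 = 1 ->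
  unit_at x^-1 (y / x ^+ 3) 0 s v -> pol a <> (x^-1 : K) * v.
Proof.
move=> a0 s1 [A [B [A0 B0 e]]] av.
have [d da] : exists d, size a = d.+1.
  by exists (size a).-1; rewrite prednK // size_poly_gt0.
have : ev x^-1 (y / x ^+ 3) ((rev_poly d a)^:P * B - 'X ^+ d.+1 * A) = 0.
  rewrite evB !evM rmorphXn /= evX evP rev_poly_horner ?da // -e av.
  by rewrite -exprVn [_ ^+ d.+1]exprS; move: (x^-1 ^+ d) => u; ring.
move/(chart_ev0 chart_infinity (sqr_rev_poly0 s1));
  rewrite hornerD hornerN !hornerM hornerD hornerN !hornerM.
rewrite !horner2E rev_poly_horner0 !horner_exp !hornerX hornerC expr0n mul0r subr0 =>
  /eqP.
rewrite mulf_eq0 (negPf B0) orbF.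
have -> : d = (size a).-1 by rewrite da.
by rewrite -lead_coefE lead_coef_eq0 (negPf a0).
Qed.

(** The local parameters are those of [has_order]. *)
Definition ord_affine (x0 y0 : C) h (n : int) :=
  exists2 v, unit_at x y x0 y0 v & h = (if y0 == 0 then y else x - cst x0) ^ n * v.

Definition ord_infinity s h (n : int) :=
  exists2 v, unit_at x^-1 (y / x ^+ 3) 0 s v & h = x^-1 ^ n * v.

Lemma ord_affine_reg x0 y0 h (n : nat) : ord_affine x0 y0 h n -> regular_at x y x0 y0 h.
Proof.
move=> [v lv ->]; apply: regularM; last exact: unit_at_regular.
rewrite -exprnP; apply: regularX; case: ifP => _.
  by rewrite -[X in regular_at _ _ _ _ X](evY x); apply: regular_ev.
have -> : x - cst x0 = ev x y ('X - x0%:P%:P).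
  by rewrite evB evX evC map_polyC hornerC.
exact: regular_ev.
Qed.

Lemma ord_infinity_reg s h (n : int) (m : nat) : 0 <= n + m%:Z ->
  ord_infinity s h n -> regular_at x^-1 (y / x ^+ 3) 0 s (h / x ^+ m).
Proof.
case nm : (n + m%:Z) => [k|//] _ [v lv ->].
have -> : x^-1 ^ n * v / x ^+ m = x^-1 ^+ k * v.
  rewrite mulrAC; congr (_ * v).
  by rewrite -exprVn [x^-1 ^+ m]exprnP [x^-1 ^+ k]exprnP -nm exprzDr ?unitrV.
apply: regularM; last exact: unit_at_regular.
by apply: regularX; rewrite -[X in regular_at _ _ _ _ X](evX _ (y / x ^+ 3));
  apply: regular_ev.
Qed.

Lemma ord_affine_unit x0 y0 A : A.[x0, y0] != 0 -> ord_affine x0 y0 (ev x y A) 0.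
Proof. by move=> A0; exists (ev x y A); [apply: unit_at_ev | rewrite expr0z mul1r]. Qed.

Lemma ord_affine_poly a x0 y0 : a.[x0] != 0 -> ord_affine x0 y0 (pol a) 0.
Proof. by move=> a0; rewrite -(ev_x _ y); apply: ord_affine_unit;
  rewrite horner2_X. Qed.

Lemma unit_at_div p q p0 q0 h g A : A.[p0, q0] != 0 -> h * ev p q A = g ->
  unit_at p q p0 q0 g -> unit_at p q p0 q0 h.
Proof.
move=> A0 <- [A' [B' [A0' B0' e]]]; exists A', (A * B').
by rewrite !hornerM mulf_neq0 // rmorphM mulrA.
Qed.

(** From [y^2 = (X - e) G] with [G] a unit at [e]. *)
Lemma ord_affine_root e : root F e -> ord_affine e 0 (pol ('X - e%:P)) 2.
Proof.
move=> Fe; have [G FE G0] := sepF Fe.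
have uG : pol G \is a GRing.unit.
  by rewrite pol_unit //; apply: contraNneq G0 => ->; rewrite horner0.
exists (pol G)^-1; last first.
  by rewrite eqxx -exprnP y2 FE rmorphM mulrK.
apply: (@unit_at_div _ _ _ _ _ 1 (G^:P)); rewrite ?horner2_X ?ev_x ?mulVr //.
by rewrite -(rmorph1 (ev x y)); apply: unit_at_ev; rewrite !hornerC oner_eq0.
Qed.

Lemma ord_infinity_poly (a : {poly C}) s n : size a = n.+1 ->
  ord_infinity s (pol a) (- n%:Z).
Proof.
move=> sa; exists (pol a / x ^+ n); last first.
  by rewrite -exprz_inv invrK -exprnP mulrC mulrVK ?unitrX.
rewrite -rev_poly_horner ?sa // -(evP _ (y / x ^+ 3)); apply: unit_at_ev.
by rewrite horner2_X rev_poly_horner0 -[n]/(n.+1.-1)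
  -sa -lead_coefE lead_coef_eq0 -size_poly_eq0 sa.
Qed.

Lemma ev_ysub l : ev x y ('X%:P - l^:P) = y - pol l.
Proof. by rewrite evB evY ev_x. Qed.

(** The product of the two factors is, up to sign or not, governed by the norm:
    [(y - l)(y + l) = F - l^2], and nonzero polynomials are invertible in [K]. *)
Lemma ysub_unit l : F - l ^+ 2 != 0 ->
  y - pol l \is a GRing.unit /\ y + pol l \is a GRing.unit.
Proof.
move=> Fl; apply/andP; rewrite -unitrM.
by rewrite (_ : _ * _ = pol (F - l ^+ 2)) ?pol_unit // polB polX -y2; ring.
Qed.

Lemma ord_ysub0 l x0 y0 : y0 != l.[x0] -> ord_affine x0 y0 (y - pol l) 0.
Proof.
move=> yl; rewrite -ev_ysub; apply: ord_affine_unit.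
by rewrite !hornerE horner2E subr_eq0.
Qed.

(** With [l = (X - x0) k] and [X - x0 = y^2 / G], one gets [y - l = y (G - k y) / G], whose last
    factor is a unit at the point. *)
Lemma ord_ysub_weierstrass l x0 : root F x0 -> root l x0 ->
  ord_affine x0 0 (y - pol l) 1.
Proof.
move=> Fx0 /factor_theorem[k lE]; have [G FE G0] := sepF Fx0.
have uF : pol F \is a GRing.unit.
  by rewrite pol_unit // -size_poly_eq0 sizeF.
have uG : pol G \is a GRing.unit.
  by rewrite pol_unit //; apply: contraNneq G0 => ->; rewrite horner0.
have uX : pol ('X - x0%:P) \is a GRing.unit by rewrite pol_unit // polyXsubC_eq0.
exists ((pol G - pol k * y) / pol G).
  apply: (@unit_at_div _ _ _ _ _ (ev x y (G^:P - k^:P * 'X%:P)) (G^:P));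
    rewrite ?horner2_X //.
    by rewrite ev_x mulrVK // evB evM !ev_x evY.
  by apply: unit_at_ev; rewrite hornerD hornerN !hornerM hornerD hornerN !hornerM
    !horner2E mulr0 subr0.
rewrite eqxx expr1z; apply: (unit_mulI uG); rewrite -[RHS]mulrA mulrVK //.
have yX : y ^+ 2 = pol ('X - x0%:P) * pol G by rewrite y2 FE rmorphM.
rewrite lE rmorphM /=; move: (pol ('X - x0%:P)) yX uX => X yX uX.
apply: (unit_mulI uX); transitivity (y * pol G * X - pol k * X * y ^+ 2).
  by rewrite yX; ring.
by ring.
Qed.

(** In [(y - l)(y + l) = F - l^2] the factor [y + l] takes the nonzero value [2 y0], so the whole
    zero of the norm belongs to [y - l]. *)
Lemma ord_ysub_zero l x0 y0 n N : y0 = l.[x0] -> y0 != 0 ->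
    F - l ^+ 2 = ('X - x0%:P) ^+ n * N -> N.[x0] != 0 ->
  ord_affine x0 y0 (y - pol l) n.
Proof.
move=> yl y0n FN N0.
have uy : y + pol l \is a GRing.unit.
  apply: (ysub_unit _).2; rewrite FN mulf_neq0 ?expf_neq0 ?polyXsubC_eq0 //.
  by apply: contraNneq N0 => ->; rewrite horner0.
exists (pol N / (y + pol l)).
  apply: (@unit_at_div _ _ _ _ _ (ev x y (N^:P)) ('X%:P + l^:P)).
  - by rewrite !hornerE horner2_X -yl -mulr2n mulrn_eq0.
  - by rewrite evD evY !ev_x mulrVK.
  - by apply: unit_at_ev; rewrite horner2_X.
rewrite (negPf y0n) -exprnP mulrA; apply: (unit_mulI uy); rewrite mulrVK //.
by rewrite -[cst x0]/(pol x0%:P) -polB -polX -polM -FN polB polX -y2; ring.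
Qed.

Lemma ysub_infinity (l : {poly C}) : (size l <= 4)%N ->
  ev x^-1 (y / x ^+ 3) ('X%:P - (rev_poly 3 l)^:P) = (y - pol l) / x ^+ 3.
Proof. by move=> sl; rewrite evB evY evP rev_poly_horner // mulrBl. Qed.

(** Divided by [x^3], the function takes the value [s - l_3] at the point at infinity. *)
Lemma ord_ysub_pole (l : {poly C}) s : (size l <= 4)%N -> s != l`_3 ->
  ord_infinity s (y - pol l) (- 3).
Proof.
move=> sl s3; exists ((y - pol l) / x ^+ 3); last first.
  by rewrite -exprz_inv invrK -exprnP mulrC mulrVK ?unitrX.
rewrite -ysub_infinity //; apply: unit_at_ev.
by rewrite !hornerE horner2_X rev_poly_horner0 subr_eq0.
Qed.

(** The norm is constant and [y + l] has a pole of order 3 here, so [y - l] has a zero of order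
    3. *)
Lemma ord_ysub_zero_infinity (l : {poly C}) s c : (size l <= 4)%N -> s = l`_3 ->
  s != 0 ->
    F - l ^+ 2 = c%:P -> c != 0 -> ord_infinity s (y - pol l) 3.
Proof.
move=> sl s3 s0 FN c0.
have yl2 : (y - pol l) * (y + pol l) = cst c.
  by rewrite -[cst c]/(pol c%:P) -FN polB polX -y2; ring.
have uy : y + pol l \is a GRing.unit.
  by apply: (ysub_unit _).2; rewrite FN polyC_eq0.
exists (cst c / ((y + pol l) / x ^+ 3)).
  apply: (@unit_at_div _ _ _ _ _ (ev x^-1 (y / x ^+ 3) c%:P%:P) ('X%:P +
    (rev_poly 3 l)^:P)).
  - by rewrite !hornerE horner2_X rev_poly_horner0 -s3 -mulr2n mulrn_eq0.
  - rewrite evD evY evP rev_poly_horner // evC map_polyC hornerC /=.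
    by rewrite -mulrDl mulrVK // unitrM uy unitrV unitrX.
  - by apply: unit_at_ev; rewrite !hornerC.
have uw : (y + pol l) / x ^+ 3 \is a GRing.unit by rewrite unitrM uy unitrV unitrX.
apply: (unit_mulI uw); rewrite -[RHS]mulrA mulrVK // -yl2 -exprnP exprVn.
by rewrite mulrA mulrC.
Qed.

End Ring.

(** * Divisor classes *)

Local Open Scope quotient_scope.

Section Jacobian.
Variable f : {poly rat}.
Local Notation fbar := (map_poly ratr f : {poly algC}).
Local Notation rf := (@ff_of_ratfun f).
Local Notation x := (ff_x f).
Local Notation y := (ff_y f).
Local Notation cl := (@divisor_class f).

Hypothesis monf : f \is monic.
Hypothesis sizef : size f = 7%N.
Hypothesis sepf : separable_poly f.

Lemma monic_fbar : fbar \is monic.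
Proof. by rewrite map_monic. Qed.

Lemma size_fbar : size fbar = 7%N.
Proof. by rewrite size_map_poly. Qed.

Lemma simple_root_fbar z : root fbar z -> exists2 G, fbar = ('X - z%:P) * G & G.[z]
  != 0.
Proof.
move=> /factor_theorem[G FE]; exists G; first by rewrite mulrC.
have : separable_poly fbar by rewrite separable_map.
by rewrite FE separable_root => /andP[].
Qed.

Lemma principalP D : reflect
  (exists2 h : function_field f, h \is a GRing.unit &
    (forall p : affine_point f, ord_affine rf y (val p).1 (val p).2 h (coeff (inl p)
      D)) /\
    (forall s : infinite_point f, ord_infinity rf y (val s) h (coeff (inr s) D)))
  (D \in @principal f).
Proof.
rewrite [D \in _]unfold_in /principal; apply: (iffP (asboolP _)) => -[h uh oh];
  exists h => //.
  by split=> [p|s]; [have := oh (inl p); case: p => -[x0 y0] | apply: (oh (inr s))].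
move: oh => [oa oi] [p|s]; last exact: oi.
by have := oa p; case: p => -[x0 y0].
Qed.

Lemma divisor_class_eq0 D : (divisor_class D == 0 :> Pic f) = (D \in @principal f).
Proof.
rewrite -[in RHS](subr0 D) Quotient.idealrBE /divisor_class.
by have := divisor_classB 0 (0 : divisor f); rewrite !subrr /divisor_class => ->.
Qed.

Definition apoint x0 y0 (e : y0 ^+ 2 == fbar.[x0]) : affine_point f :=
  exist _ (x0, y0) e.
Definition ipoint s (e : s ^+ 2 == fbar`_6) : infinite_point f := exist _ s e.

Lemma inl_eq (p q : affine_point f) : (inl p == inl q :> point f) = (val p == val q).
Proof. by []. Qed.

Lemma inr_eq (p q : infinite_point f) : (inr p == inr q :> point f) = (val p == val q).
Proof. by []. Qed.

Lemma inl_inr_eq (p : affine_point f) q : (inl p == inr q :> point f) = false.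
Proof. by []. Qed.

Lemma inr_inl_eq (p : affine_point f) q : (inr q == inl p :> point f) = false.
Proof. by []. Qed.

Lemma coef6_fbar : fbar`_6 = 1.
Proof. by move: (monicP monic_fbar); rewrite lead_coefE size_fbar. Qed.

Lemma valinfP (s : infinite_point f) : val s ^+ 2 = 1.
Proof. by rewrite (eqP (valP s)) coef6_fbar. Qed.

Lemma affineP (p : affine_point f) : (val p).2 ^+ 2 = fbar.[(val p).1].
Proof. exact/eqP/(valP p). Qed.

Definition coeffE := (coeffD, coeffB, coeffN, coeffMn, coeffU, inl_eq, inr_eq,
  inl_inr_eq, inr_inl_eq).

(** By [global_poly] a function with divisor [D] would be a polynomial in [x]; parity excludes a
    simple zero at a Weierstrass point, and the degree one at infinity. *)
Lemma nonprincipal (D : divisor f) :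
    (forall p : affine_point f, exists n : nat, coeff (inl p) D = n) ->
    (forall s : infinite_point f, 0 <= coeff (inr s) D + 2%:Z) ->
    (exists2 p : affine_point f, (val p).2 = 0 & coeff (inl p) D = 1) \/
    (exists s : infinite_point f, coeff (inr s) D = 1) ->
  D \notin @principal f.
Proof.
move=> Da Di D1; apply/principalP => -[h uh [oa oi]].
have [a ha] : exists a, h = pol rf a.
  apply: (global_poly (@ff_decomp f) (@ff_free f) (ff_y2 f)
    monic_fbar size_fbar simple_root_fbar).
    move=> x0 y0 /eqP e; have := oa (apoint e); have [n ->] := Da (apoint e).
    exact: ord_affine_reg.
  move=> s s1; have e : s ^+ 2 == fbar`_6 by rewrite s1 coef6_fbar.
  exact: ord_infinity_reg (Di (ipoint e)) (oi (ipoint e)).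
have a0 : a != 0.
  by apply: contraTneq uh => a0; rewrite ha a0 /pol tofrac0 rmorph0 unitr0.
case: D1 => [[p p0 D1]|[s D1]].
  have := oa p; rewrite /ord_affine D1 p0 eqxx ha => -[v lv]; rewrite expr1z.
  apply: (no_odd_zero (@ff_free f) (ff_y2 f) simple_root_fbar a0 _ lv).
  by apply/rootP; rewrite -affineP p0 expr0n.
have := oi s; rewrite /ord_infinity D1 ha => -[v lv]; rewrite expr1z.
exact: (no_zero_infinity (@ff_free f) (ff_y2 f) monic_fbar size_fbar a0 (valinfP s) lv).
Qed.

End Jacobian.

HB.instance Definition _ f := GRing.isZmodMorphism.Build (divisor f) (Pic f)
  (@divisor_class f) (@divisor_classB f).

(** * Relations among Weierstrass points, points at infinity and contact points *)

Section Classes.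
Variable f : {poly rat}.
Local Notation fbar := (map_poly ratr f : {poly algC}).
Local Notation rf := (@ff_of_ratfun f).
Local Notation x := (ff_x f).
Local Notation y := (ff_y f).
Local Notation cl := (@divisor_class f).

Hypothesis monf : f \is monic.
Hypothesis sizef : size f = 7%N.
Hypothesis sepf : separable_poly f.

Let simple_root := simple_root_fbar sepf.
Let size_f := size_fbar sizef.

Fact infp_proof : 1 ^+ 2 == fbar`_6. Proof. by rewrite expr1n coef6_fbar. Qed.
Fact infm_proof : (-1) ^+ 2 == fbar`_6. Proof. by rewrite sqrrN expr1n coef6_fbar. Qed.

Definition infp : point f := inr (ipoint infp_proof).
Definition infm : point f := inr (ipoint infm_proof).
Definition infdiv : divisor f := << infp >> + << infm >>.

Lemma one_neqN1 : (1 == -1 :> algC) = false.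
Proof. by rewrite -subr_eq0 opprK -[1 + 1]/(2%:R) pnatr_eq0. Qed.

Lemma N1_neq1 : (-1 == 1 :> algC) = false.
Proof. by rewrite eq_sym one_neqN1. Qed.

Lemma coeff_infdiv_affine (p : affine_point f) : coeff (inl p) infdiv = 0.
Proof. by rewrite !coeffE. Qed.

Lemma valinf (s : infinite_point f) : val s = 1 \/ val s = -1.
Proof.
have /eqP := valinfP monf sizef s; rewrite sqrf_eq1.
by case/orP => /eqP; [left | right].
Qed.

Lemma coeff_infdiv (s : infinite_point f) : coeff (inr s) infdiv = 1.
Proof.
rewrite !coeffE /= !mul1r.
by case: (valinf s) => ->; rewrite eqxx ?one_neqN1 ?N1_neq1.
Qed.

(** The relation is the divisor of [x - x(w)]. *)
Lemma double_weierstrass (w : affine_point f) : (val w).2 = 0 ->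
  cl << inl w >> *+ 2 = cl infdiv.
Proof.
move=> w0; apply/eqP; rewrite -subr_eq0 -raddfMn -raddfB divisor_class_eq0 /=.
have Fw : root fbar (val w).1 by apply/rootP; rewrite -affineP w0 expr0n.
apply/principalP; exists (pol rf ('X - (val w).1%:P)).
  by rewrite pol_unit // polyXsubC_eq0.
split=> [p|s].
  rewrite coeffB coeff_infdiv_affine subr0 coeffMn coeffU inl_eq mul1r.
  have [e|e] := eqVneq (val p).1 (val w).1.
    have p0 : (val p).2 = 0.
      by apply/eqP; rewrite -sqrf_eq0 affineP e (rootP Fw).
    have -> : val p = val w by move: e p0 w0; case: (val p) (val w) => ? ? [? ?] /= ->
      -> ->.
    by rewrite eqxx w0; apply: (ord_affine_root (ff_y2 f) simple_root Fw).
  case: eqP => [ew|_]; first by rewrite ew eqxx in e.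
  by rewrite mul0rn; apply: ord_affine_poly; rewrite !hornerE subr_eq0.
rewrite coeffB coeffMn coeffU inl_inr_eq mulr0 mul0rn sub0r coeff_infdiv.
by apply: (@ord_infinity_poly _ _ _ _ _ _ 1); rewrite size_XsubC.
Qed.

(* Five points suffice because the sum of all six is equivalent to 3 [infdiv];
   with at most five the reduced divisor has poles of order at most 2 at infinity. *)
Lemma weierstrass_indep (I : finType) (W : I -> affine_point f) (n : I -> nat) m :
    injective W -> (forall i, (val (W i)).2 = 0) -> (#|I| <= 5)%N ->
    (\sum_i n i = m.*2)%N ->
  \sum_i cl << inl (W i) >> *+ n i = cl infdiv *+ m -> forall i, ~~ odd (n i).
Proof.
move=> injW W0 cardI nm eq i; apply/negP => ni.
(* Twice a Weierstrass point is equivalent to [infdiv], so each [n i] can be replaced by its parity,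
   leaving [M] copies of [infdiv] on the right. *)
pose M := (\sum_i odd (n i))./2.
have nE : (\sum_i n i = \sum_i odd (n i) + (\sum_i (n i)./2).*2)%N.
  rewrite -muln2 big_distrl -big_split /=; apply: eq_bigr => j _.
  by rewrite -[in LHS](odd_double_half (n j)) muln2.
have ME : (\sum_i odd (n i) = M.*2)%N.
  have := congr1 odd nE; rewrite nm oddD !odd_double addbF => o.
  by rewrite -[LHS]odd_double_half -o.
have mE : m = (M + \sum_i (n i)./2)%N.
  by apply: double_inj; rewrite -nm nE ME doubleD.
have M2 : (M <= 2)%N.
  have : (M.*2 <= 5)%N.
    rewrite -ME; apply: leq_trans cardI; rewrite -sum1_card.
    by apply: leq_sum => j _; case: odd.
  by case: M {ME mE nE} => [|[|[]]].
have : cl (\sum_i << inl (W i) >> *+ odd (n i) - infdiv *+ M) == 0.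
  rewrite raddfB raddf_sum subr_eq0 raddfMn /=.
  apply/eqP/(addIr (cl infdiv *+ (\sum_i (n i)./2))).
  rewrite -mulrnDr -mE -eq -sumrMnr -big_split /=; apply: eq_bigr => j _.
  by rewrite -(double_weierstrass (W0 j))
    -mulrnA raddfMn -mulrnDr mul2n odd_double_half.
rewrite divisor_class_eq0; apply/negP; apply: nonprincipal => //.
- move=> p; exists (\sum_j (val (W j) == val p) * odd (n j))%N.
  rewrite coeffB coeffMn coeff_infdiv_affine mul0rn subr0 raddf_sum /= -[RHS]natz
    natr_sum.
  by apply: eq_bigr => j _; rewrite coeffMn coeffU inl_eq mul1r natrM mulr_natr.
- move=> s; rewrite coeffB coeffMn coeff_infdiv raddf_sum /= big1 => [|j _].
    by rewrite sub0r addrC subr_ge0 -(natz 2) ler_nat.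
  by rewrite coeffMn coeffU inl_inr_eq mulr0 mul0rn.
left; exists (W i); first exact: W0.
rewrite coeffB coeffMn coeff_infdiv_affine mul0rn subr0 raddf_sum (bigD1 i) //=.
rewrite coeffMn coeffU eqxx ni big1 ?addr0 // => j ji.
rewrite coeffMn coeffU inl_eq (inj_eq val_inj) (inj_eq injW) (negPf ji).
by rewrite mulr0 mul0rn.
Qed.

Lemma infinity_difference_neq0 : cl (<< infp >> - << infm >>) != 0.
Proof.
rewrite divisor_class_eq0; apply: nonprincipal => //.
- by move=> p; exists 0%N; rewrite !coeffE.
- move=> s; rewrite !coeffE /= !mul1r.
  by case: (valinf s) => ->; rewrite eqxx ?one_neqN1 ?N1_neq1.
by right; exists (ipoint infp_proof); rewrite !coeffE /= !mul1r eqxx N1_neq1.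
Qed.

(** The function [y - l] has nonzero constant norm, hence no affine zero; as [y / x^3] is 1 at
    [infp] and -1 at [infm], it has a triple zero at the former and a triple pole at the latter. *)
Lemma infinity_difference_torsion (l : {poly algC}) c : (size l <= 4)%N -> l`_3 = 1 ->
  fbar - l ^+ 2 = c%:P -> c != 0 -> cl (<< infp >> - << infm >>) *+ 3 = 0.
Proof.
move=> sl l3 Fl c0; apply/eqP; rewrite -raddfMn divisor_class_eq0 /=.
apply/principalP; exists (y - pol rf l).
  by apply: (ysub_unit (ff_y2 f) _).1; rewrite Fl polyC_eq0.
split=> [p|s].
  rewrite (_ : coeff _ _ = 0); last by rewrite !coeffE.
  apply: ord_ysub0; apply: contraNneq c0 => e; have := congr1 (horner^~ (val p).1) Fl.
  by rewrite hornerC hornerD hornerN horner_exp -affineP -e subrr => <-.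
case: (valinf s) => es.
  rewrite (_ : coeff _ _ = 3); last by rewrite !coeffE es /= eqxx N1_neq1.
  by rewrite es; apply: (ord_ysub_zero_infinity (ff_y2 f) sl _ _ Fl c0);
    rewrite ?l3 ?oner_eq0.
rewrite (_ : coeff _ _ = - 3); last by rewrite !coeffE es /= eqxx one_neqN1.
by rewrite es; apply: ord_ysub_pole; rewrite // l3 N1_neq1.
Qed.

(* The curve y = l(x) meets X in two Weierstrass points, is tangent to it at [p1]
   and [p2], and has contact with neither branch at infinity. *)
Lemma bitangent_class (l : {poly algC}) (c r1 r2 : algC) (w1 w2 p1 p2 : affine_point f)
  :
    (size l <= 4)%N -> l`_3 ^+ 2 != 1 -> c != 0 ->
    fbar - l ^+ 2 = c%:P * ('X - (val w1).1%:P) * ('X - (val w2).1%:P)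
                       * ('X - r1%:P) ^+ 2 * ('X - r2%:P) ^+ 2 ->
    (val w1).2 = 0 -> (val w2).2 = 0 -> w1 != w2 ->
    root l (val w1).1 -> root l (val w2).1 ->
    val p1 = (r1, l.[r1]) -> val p2 = (r2, l.[r2]) -> l.[r1] != 0 -> l.[r2] != 0 ->
  cl << inl w1 >> + cl << inl w2 >> + cl (<< inl p1 >> + << inl p2 >>) *+ 2 =
    cl infdiv *+ 3.
Proof.
move=> sl l3 c0 Fl w10 w20 w12 lw1 lw2 e1 e2 l1 l2.
have rw (w : affine_point f) : (val w).2 = 0 -> root fbar (val w).1.
  by move=> w0; apply/rootP; rewrite -affineP w0 expr0n.
have Fl0 : fbar - l ^+ 2 != 0.
  by rewrite Fl !mulf_neq0 ?expf_neq0 ?polyXsubC_eq0 ?polyC_eq0.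
apply/eqP; rewrite -subr_eq0 -!raddfMn -!raddfD -raddfB divisor_class_eq0 /=.
apply/principalP; exists (y - pol rf l); first by apply: (ysub_unit (ff_y2 f) Fl0).1.
split=> [p|s]; last first.
  rewrite (_ : coeff _ _ = - 3); last by rewrite coeffB coeffMn coeff_infdiv !coeffE.
  apply: ord_ysub_pole => //; apply: contraNneq l3 => <-.
  by rewrite (valinfP monf sizef).
rewrite coeffB coeffMn coeff_infdiv_affine mul0rn subr0 !coeffE !mul1r e1 e2.
(* Off the curve y = l(x) the function is a unit, and [p] is none of the four contact points. *)
have [yp|yp] := eqVneq (val p).2 l.[(val p).1]; last first.
  have nw (w : affine_point f) : (val w).2 = 0 -> root l (val w).1 ->
    (val w == val p) = false.
    by move=> w0 lw; apply: contraNF yp => /eqP<-; rewrite w0 (rootP lw).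
  have nr r : ((r, l.[r]) == val p) = false by apply: contraNF yp => /eqP<-.
  by rewrite !nw // !nr; apply: ord_ysub0.
have ew (w : affine_point f) : (val w).2 = 0 -> root l (val w).1 ->
    (val w == val p) = ((val w).1 == (val p).1).
  move=> w0 lw; rewrite -pair_eqE /pair_eq; case: eqP => //= e.
  by rewrite w0 yp -e (rootP lw) eqxx.
have er r : ((r, l.[r]) == val p) = (r == (val p).1).
  by rewrite -pair_eqE /pair_eq /=; case: eqP => //= ->; rewrite yp eqxx.
have w12x : (val w1).1 != (val w2).1.
  apply: contraNneq w12 => e; rewrite -val_eqE; apply/eqP.
  by move: e w10 w20; case: (val w1) (val w2) => ? ? [? ?] /= -> -> ->.
have rw0 r (w : affine_point f) : l.[r] != 0 -> root l (val w).1 -> (val w).1 != r.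
  by move=> lr lw; apply: contraNneq lr => <-; rewrite (rootP lw).
rewrite !ew // !er.
(* On that curve the norm vanishes at [p], so the abscissa of [p] is one of its four listed
   roots. *)
have := congr1 (horner^~ (val p).1) Fl.
rewrite hornerD hornerN horner_exp -affineP -yp subrr => /esym/eqP.
rewrite !hornerM !hornerXsubC hornerC !mulf_eq0 (negPf c0) /= !subr_eq0 !orbb.
move: (val p).1 (val p).2 yp => x0 y0 yp {p ew er}.
have wcase (w : affine_point f) : (val w).2 = 0 -> root l (val w).1 ->
    x0 = (val w).1 -> ord_affine rf y x0 y0 (y - pol rf l) 1.
  move=> w0 lw e; rewrite yp e (rootP lw).
  exact: (ord_ysub_weierstrass (ff_y2 f) size_f simple_root (rw w w0) lw).
have [e _|n1 /=] := eqVneq x0 (val w1).1.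
  rewrite e [_ == (val w1).1]eq_sym (negPf w12x)
    ![_ == (val w1).1]eq_sym !(negPf (rw0 _ _ _ lw1)) //.
  by rewrite -e; apply: wcase w10 lw1 e.
have [e _|n2 /=] := eqVneq x0 (val w2).1.
  rewrite e ![_ == (val w2).1]eq_sym !(negPf (rw0 _ _ _ lw2)) //.
  by rewrite -e; apply: wcase w20 lw2 e.
have [e|n3] := eqVneq x0 r1; have [e'|n4] := eqVneq x0 r2 => //= _.
(* If [r1 = r2] the two tangencies merge into one contact of order 4. *)
- apply: (@ord_ysub_zero _ _ _ _ _ (ff_y2 f) _ _ _ 4
      (c%:P * ('X - (val w1).1%:P) * ('X - (val w2).1%:P))) => //.
  + by rewrite yp e.
  + by rewrite Fl -e -e'; ring.
  by rewrite !hornerM !hornerXsubC hornerC !mulf_neq0 ?subr_eq0.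
- apply: (@ord_ysub_zero _ _ _ _ _ (ff_y2 f) _ _ _ 2
      (c%:P * ('X - (val w1).1%:P) * ('X - (val w2).1%:P) * ('X - r2%:P) ^+ 2)) => //.
  + by rewrite yp e.
  + by rewrite Fl -e; ring.
  by rewrite !hornerM !hornerXsubC hornerC !mulf_neq0 ?subr_eq0.
- apply: (@ord_ysub_zero _ _ _ _ _ (ff_y2 f) _ _ _ 2
      (c%:P * ('X - (val w1).1%:P) * ('X - (val w2).1%:P) * ('X - r1%:P) ^+ 2)) => //.
  + by rewrite yp e'.
  + by rewrite Fl -e'; ring.
  by rewrite !hornerM !hornerXsubC hornerC !mulf_neq0 ?subr_eq0.
Qed.

End Classes.

(** * The homomorphism *)

Section Hom.
Variables (G : zmodType) (T1 T2 T3 T : G).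
Hypotheses (T1_2 : T1 *+ 2 = 0) (T2_2 : T2 *+ 2 = 0) (T3_2 : T3 *+ 2 = 0).
Hypothesis T_12 : T *+ 12 = 0.

Lemma mulrn_mod (g : G) n m : g *+ n = 0 -> g *+ (m %% n) = g *+ m.
Proof.
by move=> g0; rewrite [in RHS](divn_eq m n) mulrnDr mulnC mulrnA g0 mul0rn add0r.
Qed.

Lemma mulrn_ZpB (g : G) n (i j : 'I_n.+1) : g *+ n.+1 = 0 ->
  g *+ (i - j)%R = g *+ i - g *+ j.
Proof.
move=> g0; rewrite /= !mulrn_mod // mulrnDr mulrn_mod //; congr (_ + _).
apply/eqP; rewrite -addr_eq0 -mulrnDr addnC subnKC ?g0 //.
by rewrite ltnW.
Qed.

Definition Zp_hom (z : 'Z_2 * 'Z_2 * 'Z_2 * 'Z_12) : G :=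
  T1 *+ z.1.1.1 + T2 *+ z.1.1.2 + T3 *+ z.1.2 + T *+ z.2.

Lemma Zp_hom_is_zmod_morphism : zmod_morphism Zp_hom.
Proof.
move=> z z'; rewrite /Zp_hom !mulrn_ZpB //.
rewrite !opprD [RHS]addrACA; congr (_ + _); rewrite [RHS]addrACA; congr (_ + _).
by rewrite addrACA.
Qed.

End Hom.

(** The generator of ['Z_12] goes to [D4 + D3]. Injectivity separates the primes 3 and 2, and the
    2-part is detected by the 2-torsion elements [T1, T2, T3, 2 D4]. *)
Lemma Zp_embedding (G : zmodType) (T1 T2 T3 D3 D4 : G) :
    T1 *+ 2 = 0 -> T2 *+ 2 = 0 -> T3 *+ 2 = 0 -> D3 *+ 3 = 0 -> D4 *+ 4 = 0 ->
    D3 != 0 ->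
    (forall i j k l, T1 *+ i + T2 *+ j + T3 *+ k + D4 *+ 2 *+ l = 0 ->
      [/\ ~~ odd i, ~~ odd j, ~~ odd k & ~~ odd l]) ->
  exists phi : {additive 'Z_2 * 'Z_2 * 'Z_2 * 'Z_12 -> G}, injective phi.
Proof.
move=> t1 t2 t3 d3 d4 d3n indep.
have t : (D4 + D3) *+ 12 = 0.
  by rewrite mulrnDl (mulrnA D4 4 3) (mulrnA D3 3 4) d4 d3 !mul0rn addr0.
pose phi : {additive 'Z_2 * 'Z_2 * 'Z_2 * 'Z_12 -> G} :=
  HB.pack (Zp_hom T1 T2 T3 (D4 + D3)) (GRing.isZmodMorphism.Build _ _
    (Zp_hom T1 T2 T3 (D4 + D3)) (Zp_hom_is_zmod_morphism t1 t2 t3 t)).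
exists phi; apply: raddf_inj => -[[[i j] k] l]; rewrite /= /Zp_hom /=.
rewrite mulrnDl => e.
have even_val (n : nat) : (n < 2)%N -> ~~ odd n -> n = 0%N by case: n => [|[]].
(* Multiplication by 4 kills everything but the [D3] term and fixes that one. *)
have l3 : (3 %| l)%N.
  have : D3 *+ l = 0.
    have := congr1 (fun g => g *+ 4) e; rewrite mul0rn !mulrnDl -!mulrnA.
    rewrite ![(_ * 4)%N]mulnC !mulrnA (mulrnA T1 2 2) (mulrnA T2 2 2) (mulrnA T3 2 2).
    by rewrite t1 t2 t3 d4 !mul0rn !add0r mulrS d3 addr0.
  rewrite -(mulrn_mod _ d3) /dvdn; case: (l %% 3)%N (ltn_pmod l (isT : 0 < 3)%N)
    => [|[|[|//]]] // _.
    by rewrite mulr1n => d0; rewrite d0 eqxx in d3n.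
  by move=> d0; move: d3; rewrite mulrS d0 addr0 => d3; rewrite d3 eqxx in d3n.
have {}e : T1 *+ i + T2 *+ j + T3 *+ k + D4 *+ l = 0.
  rewrite -[RHS]e; congr (_ + _).
  by rewrite -[X in D3 *+ X](divnK l3) mulnC mulrnA d3 mul0rn addr0.
(* Doubling leaves only [2 D4]; once [l] is even, the original relation is itself one among the
   2-torsion elements. *)
have l2 : ~~ odd l.
  have e2 : D4 *+ 2 *+ l = 0.
    transitivity ((T1 *+ i + T2 *+ j + T3 *+ k + D4 *+ l) *+ 2);
      last by rewrite e mul0rn.
    by rewrite !(mulrnDl 2) !(mulrnAC _ _ 2) t1 t2 t3 !mul0rn !add0r.
  by case: (indep 0 0 0 l)%N => //; rewrite !mulr0n !add0r.
have [] := indep i j k l./2.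
  by rewrite -mulrnA mul2n even_halfK.
move=> /(even_val _ (ltn_ord i)) i0 /(even_val _ (ltn_ord j)) j0.
move=> /(even_val _ (ltn_ord k)) k0 l4.
have l0 : l = 0%N :> nat.
  move: l3 l2 l4 (ltn_ord l); rewrite /dvdn; move: (l : nat) => m.
  by do 12! [case: m => [|m]; first by []].
by congr (_, _, _, _); apply: val_inj.
Qed.

(** * Rational classes *)

Section RationalClasses.
Variable f : {poly rat}.
Local Notation fbar := (map_poly ratr f : {poly algC}).
Local Notation cl := (@divisor_class f).
Local Notation J := (jacobian_rat_points f).

Hypothesis monf : f \is monic.
Hypothesis sizef : size f = 7%N.
Hypothesis sepf : separable_poly f.
Local Notation infp := (infp monf sizef).
Local Notation infm := (infm monf sizef).
Local Notation infdiv := (infdiv monf sizef).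

Lemma conj_divisorB sigma : {morph @conj_divisor f sigma : D E / D - E}.
Proof. by move=> D E; rewrite /conj_divisor lift_is_additive. Qed.
HB.instance Definition _ sigma := GRing.isZmodMorphism.Build (divisor f) (divisor f)
  (@conj_divisor f sigma) (@conj_divisorB sigma).

Lemma conj_divisorU sigma P : @conj_divisor f sigma << P >> = << conj_point sigma P >>.
Proof. by rewrite /conj_divisor liftU scale1r. Qed.

Lemma jac_of_divisor D : deg D = 0 -> (forall sigma,
  cl (conj_divisor sigma D) = cl D) ->
  exists c : J, val c = cl D.
Proof.
move=> d0 inv; have cD : cl D \in @rational_class0 f.
  by rewrite [_ \in _]unfold_in; apply/asboolP; exists D.
by exists (JacPoint cD).
Qed.

Fact base_point_proof : sqrtC fbar.[0] ^+ 2 == fbar.[0].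
Proof. by rewrite sqrtCK. Qed.

(** Off the curve the value is an arbitrary default, a point above [x = 0]. *)
Definition affpt (z : algC * algC) : affine_point f :=
  insubd (apoint base_point_proof) z.

Lemma val_affpt z : z.2 ^+ 2 = fbar.[z.1] -> val (affpt z) = z.
Proof. by move=> e; rewrite /affpt insubdK // unfold_in; apply/eqP. Qed.

Lemma conj_affpt (sigma : {rmorphism algC -> algC}) z : z.2 ^+ 2 = fbar.[z.1] ->
  conj_point sigma (inl (affpt z)) = inl (affpt (sigma z.1, sigma z.2)).
Proof.
move=> e; apply/eqP; rewrite inl_eq.
have -> : val (affpt (sigma z.1, sigma z.2)) = (sigma z.1, sigma z.2).
  by rewrite val_affpt //= -rmorphXn e -horner_map fbar_conj.
apply/eqP; transitivity (sigma (val (affpt z)).1, sigma (val (affpt z)).2) => //.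
by rewrite val_affpt.
Qed.

Lemma conj_infp sigma : conj_point sigma infp = infp.
Proof. by apply/eqP; rewrite inr_eq /= rmorph1. Qed.

Lemma conj_infm sigma : conj_point sigma infm = infm.
Proof. by apply/eqP; rewrite inr_eq /= rmorphN1. Qed.

Definition wpoint (r : rat) : affine_point f := affpt (ratr r, 0).

Lemma wpoint_eq (r : rat) : root f r -> 0 ^+ 2 = fbar.[ratr r].
Proof. by move/rootP=> r0; rewrite horner_map r0 rmorph0 expr0n. Qed.

Lemma val_wpoint r : root f r -> val (wpoint r) = (ratr r, 0).
Proof. by move=> r0; rewrite val_affpt //; apply: wpoint_eq. Qed.

Lemma conj_wpoint sigma r : root f r -> conj_point sigma (inl (wpoint r))
  = inl (wpoint r).
Proof.
move=> r0; rewrite conj_affpt ?rmorph0; last exact: wpoint_eq.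
by have -> : sigma (ratr r) = ratr r := fmorph_eq_rat (sigma \o ratr) r.
Qed.

Lemma jac_weierstrass r s : root f r -> root f s ->
  exists c : J, val c = cl (<< inl (wpoint r) >> - << inl (wpoint s) >>).
Proof.
move=> r0 s0; apply: jac_of_divisor; first by rewrite degB !degU.
by move=> sigma; rewrite raddfB /= !conj_divisorU !conj_wpoint.
Qed.

Lemma jac_infinity : exists c : J, val c = cl (<< infp >> - << infm >>).
Proof.
apply: jac_of_divisor; first by rewrite degB !degU.
by move=> sigma; rewrite raddfB /= !conj_divisorU conj_infp conj_infm.
Qed.

(** The class [d] is that of the two contact points over the roots of [q], minus [infdiv]; its
    double is read off from [bitangent_class]. It is rational although the contact points need not
    be. *)
Lemma jac_half (l q : {poly rat}) (c r s : rat) :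
    (size l <= 4)%N -> l`_3 ^+ 2 != 1 -> c != 0 -> q \is monic -> size q = 3%N ->
    f - l ^+ 2 = c%:P * ('X - r%:P) * ('X - s%:P) * q ^+ 2 ->
    root f r -> root f s -> r != s -> root l r -> root l s ->
  exists2 d : J, val d *+ 4 = 0 &
    val d *+ 2 = cl infdiv - cl << inl (wpoint r) >> - cl << inl (wpoint s) >>.
Proof.
move=> sl l3 c0 mq sq fl fr fs rs lr ls.
pose lb := map_poly ratr l : {poly algC}; pose qb := map_poly ratr q : {poly algC}.
have Fl : fbar - lb ^+ 2 = (ratr c)%:P * ('X - (ratr r)%:P) * ('X - (ratr s)%:P)
  * qb ^+ 2.
  have := congr1 (map_poly (ratr : rat -> algC)) fl.
  rewrite rmorphB /= rmorphXn /= -/lb => ->.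
  rewrite rmorphM /= rmorphXn /= [map_poly _ (_ * _ * _)]rmorphM rmorphM /=.
  by rewrite !map_polyXsubC map_polyC.
have [z1 [z2 qE]] : exists z1 z2, qb = ('X - z1%:P) * ('X - z2%:P).
  have [zs] := closed_field_poly_normal qb.
  have lq : lead_coef qb = 1 by apply/monicP; rewrite map_monic.
  rewrite lq scale1r => qzs.
  have : size qb = 3%N by rewrite size_map_poly.
  rewrite [in size _]qzs size_prod_XsubC; case: zs qzs => [|z1 [|z2 []]] // qzs _.
  by exists z1, z2; rewrite qzs !big_cons big_nil mulr1.
have X0 z : 'X - z%:P != 0 :> {poly algC} by rewrite polyXsubC_eq0.
(* A common root of [l] and [q] would be a double root of [f]. *)
have nz z : root qb z -> lb.[z] != 0.
  move=> qz; apply/negP => /factor_theorem[l1 lE]; have /factor_theorem[q1 q1E] := qz.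
  have FE : fbar = lb ^+ 2 + (ratr c)%:P * ('X - (ratr r)%:P) * ('X - (ratr s)%:P)
    * qb ^+ 2.
    by rewrite -Fl addrC subrK.
  have Fz : root fbar z.
    by apply/rootP; rewrite FE lE q1E !(hornerXsubC, hornerM, hornerD, subrr, mulr0,
      mul0r, addr0).
  have [G GE G0] := simple_root_fbar sepf Fz.
  have : G = ('X - z%:P) * (l1 ^+ 2 + (ratr c)%:P * ('X - (ratr r)%:P) * ('X -
    (ratr s)%:P) * q1 ^+ 2).
    by apply: (mulfI (X0 z)); rewrite -GE FE lE q1E; ring.
  by move=> e; rewrite e hornerM hornerXsubC subrr mul0r eqxx in G0.
have q1z : root qb z1 by rewrite qE rootM root_XsubC eqxx.
have q2z : root qb z2 by rewrite qE rootM !root_XsubC eqxx orbT.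
have pz z : root qb z -> lb.[z] ^+ 2 = fbar.[z].
  move=> qz; have := congr1 (horner^~ z) Fl; rewrite !hornerM (rootP qz) !mulr0.
  by rewrite hornerD hornerN horner_exp => /eqP; rewrite subr_eq0 => /eqP ->.
pose P z := affpt (z, lb.[z]).
have [d dE] : exists d : J, val d = cl (<< inl (P z1) >> + << inl (P z2) >> - infdiv).
  apply: jac_of_divisor; first by rewrite degB !degD !degU.
  move=> sigma; congr (cl _); rewrite raddfB !raddfD /= !conj_divisorU conj_infp
    conj_infm.
  congr (_ + _); have cP z : root qb z -> conj_point sigma (inl (P z))
    = inl (P (sigma z)).
    by move=> qz; rewrite conj_affpt /= ?pz // -horner_map fbar_conj.
  rewrite !cP //.
  (* As [q] is rational, [sigma] permutes its roots; as [l] is rational too, it permutes the contact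
     points. *)
  have e : ('X - (sigma z1)%:P) * ('X - (sigma z2)%:P) = ('X - z1%:P) * ('X - z2%:P).
    by rewrite -qE -[RHS](fbar_conj q sigma) -/qb qE rmorphM /= !map_polyXsubC.
  have : root qb (sigma z1) by rewrite qE -e rootM root_XsubC eqxx.
  rewrite qE rootM !root_XsubC => /orP[] /eqP ez1; move: e; rewrite ez1.
    by move/(mulfI (X0 z1))/addrI/oppr_inj/polyC_inj->.
  by rewrite [RHS]mulrC => /(mulfI (X0 z2))/addrI/oppr_inj/polyC_inj->; rewrite addrC.
have dE2 : val d *+ 2 = cl infdiv - cl << inl (wpoint r) >> - cl << inl (wpoint s) >>.
  have wE t : root f t -> val (wpoint t) = (ratr t, 0) by apply: val_wpoint.
  have cb : ratr c != 0 :> algC by rewrite fmorph_eq0.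
  have := @bitangent_class f monf sizef sepf lb (ratr c) z1 z2 (wpoint r) (wpoint s)
    (P z1) (P z2).
  rewrite !wE // !val_affpt /= ?pz // => H.
  have {H} e : cl << inl (wpoint r) >> + cl << inl (wpoint s) >> +
      cl (<< inl (P z1) >> + << inl (P z2) >>) *+ 2 = cl infdiv *+ 3.
    apply: H => //.
    - by rewrite size_map_poly.
    - by rewrite coef_map -rmorphXn fmorph_eq1.
    - by rewrite Fl qE; ring.
    - by rewrite -val_eqE !wE // xpair_eqE eqxx andbT fmorph_eq.
    - by rewrite /root horner_map (rootP lr) rmorph0.
    - by rewrite /root horner_map (rootP ls) rmorph0.
    - exact: nz.
    - exact: nz.
  rewrite dE raddfB mulrnBl /= -[X in X - _](addKr (cl << inl (wpoint r) >> +
    cl << inl (wpoint s) >>)).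
  by rewrite e mulrS addrA addrK addrC opprD addrA.
exists d => //; rewrite (mulrnA _ 2 2)
  dE2 !mulrnBl !(double_weierstrass monf sizef sepf) ?val_wpoint //.
by rewrite mulrS mulr1n addrK subrr.
Qed.

End RationalClasses.

(** Since [2X = K] gives [-X = X - K], signs can be removed, which puts the relation in the form
    that [weierstrass_indep] takes; the trailing 0 comes from unfolding its sum. *)
Lemma difference_relation (G : zmodType) (A B U V O K : G) i j k l :
    O *+ 2 = K -> U *+ 2 = K -> V *+ 2 = K ->
    (A - O) *+ i + (B - O) *+ j + (U - O) *+ k + (K - U - V) *+ l = 0 ->
  A *+ i + (B *+ j + (U *+ (k + l) + (V *+ l + (O *+ (i + j + k) + 0)))) = K *+ (i +
    j + k + l).
Proof.
move=> OK UK VK.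
have sym (X : G) : X *+ 2 = K -> - X = X - K by move=> <-; rewrite opprD addNKr.
have -> : K - U - V = U + V - K.
  by rewrite (sym U) // (sym V) // [K + _]addrC subrK addrA.
rewrite (sym O) // !addrA !(mulrnBl, mulrnDl) => e.
apply/eqP; rewrite -subr_eq0 -[eqbRHS]e !mulrnDr addr0 !opprD; apply/eqP.
by rewrite [LHS](AC (1*1*2*1*3*4) (1*6*9*(2*7*10)*(3*8*11)*(4*5*12))).
Qed.

(** * Assembling the generators *)

Section Embedding.
Variable f : {poly rat}.
Hypothesis monf : f \is monic.
Hypothesis sizef : size f = 7%N.
Hypothesis sepf : separable_poly f.

(** Here [g] yields the class of order 3 and [l, q] the class of order 4 whose double involves [r3]
    and [r4]; [r0] is the base point of the other 2-torsion classes. *)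
Lemma jacobian_embedding (g l q : {poly rat}) (d c r0 r1 r2 r3 r4 : rat) :
    uniq [:: r0; r1; r2; r3; r4] -> all (root f) [:: r0; r1; r2; r3; r4] ->
    (size g <= 4)%N -> g`_3 = 1 -> f - g ^+ 2 = d%:P -> d != 0 ->
    (size l <= 4)%N -> l`_3 ^+ 2 != 1 -> root l r3 -> root l r4 ->
    c != 0 -> q \is monic -> size q = 3%N ->
    f - l ^+ 2 = c%:P * ('X - r3%:P) * ('X - r4%:P) * q ^+ 2 ->
  exists phi : {additive 'Z_2 * 'Z_2 * 'Z_2 * 'Z_12 -> jacobian_rat_points f},
    injective phi.
Proof.
move=> ur /[dup] rts /and5P[f0 f1 f2 f3 /andP[f4 _]]
  sg g3 gE d0 sl l3 lr3 lr4 c0 mq sq lE.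
have r34 : r3 != r4 by move: ur => /= /and5P[_ _ _]; rewrite inE.
pose E r := divisor_class (<< inl (wpoint f r) >> : divisor f).
have EE r : root f r -> E r *+ 2 = divisor_class (infdiv monf sizef).
  by move=> fr; apply: double_weierstrass => //; rewrite val_wpoint.
have valMn (t : jacobian_rat_points f) n : val (t *+ n) = val t *+ n := raddfMn val n t.
have half r : root f r -> exists2 t : jacobian_rat_points f, t *+ 2 = 0 &
  val t = E r - E r0.
  move=> fr; have [t tE] := jac_weierstrass fr f0; exists t; last by rewrite tE raddfB.
  by apply: val_inj; rewrite valMn tE raddfB mulrnBl !EE // subrr.
have [t1 t1_2 t1E] := half _ f1; have [t2 t2_2 t2E] := half _ f2.
have [t3 t3_2 t3E] := half _ f3.
have [d3 d3E] := jac_infinity monf sizef.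
have [d4 d4_4 d4E] := jac_half monf sizef sepf sl l3 c0 mq sq lE f3 f4 r34 lr3 lr4.
apply: (Zp_embedding t1_2 t2_2 t3_2 (_ : d3 *+ 3 = 0) (_ : d4 *+ 4 = 0)).
- apply: val_inj; rewrite valMn d3E.
  apply: (@infinity_difference_torsion _ _ _ (map_poly ratr g) (ratr d)).
  + by rewrite size_map_poly.
  + by rewrite coef_map /= g3 rmorph1.
  + by rewrite -rmorphXn -rmorphB /= gE map_polyC.
  by rewrite fmorph_eq0.
- by apply: val_inj; rewrite valMn.
- apply: contraNneq (infinity_difference_neq0 monf sizef sepf) => d30.
  by rewrite -d3E d30.
move=> i j k m e.
have {}e : (E r1 - E r0) *+ i + (E r2 - E r0) *+ j + (E r3 - E r0) *+ k +
    (divisor_class (infdiv monf sizef) - E r3 - E r4) *+ m = 0.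
  by rewrite -t1E -t2E -t3E -d4E -!valMn -!(raddfD val) e.
have {}e := difference_relation (EE _ f0) (EE _ f3) (EE _ f4) e.
pose rs := [:: r1; r2; r3; r4; r0].
(* Coefficients of the points of [rs]; they add up to twice [i + j + k + m]. Evenness of [m] and
   [k + m] gives that of [k]. *)
pose ns := [:: i; j; k + m; m; i + j + k]%N.
have frs (a : 'I_5) : root f rs`_a.
  by apply: (allP (_ : all (root f) rs)); rewrite ?mem_nth // /= f1 f2 f3 f4 f0.
have := @weierstrass_indep f monf sizef sepf 'I_5 (fun a => wpoint f rs`_a)
  (fun a => nth 0 ns a) (i + j + k + m)%N.
rewrite !big_ord_recl !big_ord0 /= => H.
have {}H a : ~~ odd (nth 0 ns a)%N.
  have [a5|a5] := ltnP a 5; last by rewrite nth_default.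
  apply: (H _ _ _ _ e (Ordinal a5)).
  - move=> b b' /(congr1 val); rewrite !val_wpoint // => -[] /fmorph_inj /eqP.
    rewrite nth_uniq //; first by move=> /eqP; apply: val_inj.
    by rewrite -(rot_uniq 4).
  - by move=> b; rewrite val_wpoint.
  - by rewrite card_ord.
  by rewrite -addnn; ring.
move: (H 0%N) (H 1%N) (H 2%N) (H 3%N) => /= -> -> hk hm; split=> //.
by move: hk; rewrite oddD (negPf hm) addbF.
Qed.

End Embedding.

(** * The sextic *)

(* With [X^2 - p X + w^2 = h] and [2 s1 s3 = s2^2 - w^2], this is the identity
   [k^2 x (x - A)(x - B)(x - C) = h M^2 - Q^2] of the header. *)
Lemma bitangent_identity (R : comNzRingType) (X s1 s2 s3 w p : R) :
    p = s1 ^+ 2 - 2%:R * s2 -> 2%:R * s1 * s3 = s2 ^+ 2 - w ^+ 2 ->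
  (2%:R * s1) ^+ 2 * (p - 2%:R * w) *
    (X * (X ^+ 3 - p * X ^+ 2 + w ^+ 2 * X - s3 ^+ 2)) =
  (X ^+ 2 - p * X + w ^+ 2) * (2%:R * (s2 + w - s1 ^+ 2) * X + (s2 + w) ^+ 2) ^+ 2 -
  ((s2 + w) * (2%:R * X ^+ 2 + (w + 3%:R * s2 - 2%:R * s1 ^+ 2) * X
    + w * (s2 + w))) ^+ 2.
Proof.
move=> pE sE; transitivity ((p - 2%:R * w) * X *
  ((2%:R * s1) ^+ 2 * (X ^+ 3 - p * X ^+ 2 + w ^+ 2 * X) - (2%:R * s1 * s3) ^+ 2)).
  by ring.
by rewrite sE pE; ring.
Qed.

Lemma scale_identity (R : comNzRingType) (K L x h t : R) : K * L = 1 ->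
  x * h * t = h * L ^+ 2 * (K ^+ 2 * (x * t)).
Proof. by move=> KL; rewrite -[LHS]mul1r -(expr1n R 2) -KL; ring. Qed.

Lemma X_sexticE a b c u v : X_sextic a b c u v =
  \prod_(r <- [:: 0; a ^+ 2; b ^+ 2; c ^+ 2; u ^+ 2; v ^+ 2]) ('X - r%:P).
Proof. by rewrite !big_cons big_nil mulr1 polyC0 subr0 !mulrA. Qed.

(** The sum [a + b + c] is a factor of the denominator [k] of the bitangent cubic, and its
    nonvanishing also gives [n != 0]. *)
Lemma X_sextic_embedding a b c u v : in_S_open a b c u v -> a + b + c != 0 ->
  exists phi : {additive 'Z_2 * 'Z_2 * 'Z_2 * 'Z_12 ->
                         jacobian_rat_points (X_sextic a b c u v)},
    injective phi.
Proof.
move=> [[e1 e4] /and5P[a0 b0 c0 u0 v0] un] s0.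
have e2 : a ^+ 2 * b ^+ 2 + b ^+ 2 * c ^+ 2 + c ^+ 2 * a ^+ 2 = u ^+ 2 * v ^+ 2.
  apply: (mulfI (_ : 2%:R != 0)) => //.
  transitivity ((a ^+ 2 + b ^+ 2 + c ^+ 2) ^+ 2 - (a ^+ 4 + b ^+ 4 + c ^+ 4));
    first by ring.
  by rewrite e1 e4; ring.
have ur : uniq [:: 0; a ^+ 2; b ^+ 2; c ^+ 2; u ^+ 2; v ^+ 2].
  by rewrite cons_uniq un andbT !inE ![0 == _]eq_sym !expf_eq0 /= !negb_or a0 b0 c0
    u0 v0.
have fE := X_sexticE a b c u v; set f := X_sextic a b c u v in fE *.
have sf : size f = 7%N by rewrite fE size_prod_XsubC.
have mf : f \is monic by rewrite fE monic_prod_XsubC.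
have sepf : separable_poly f by rewrite fE separable_prod_XsubC.
have rf r : root f r = (r \in [:: 0; a ^+ 2; b ^+ 2; c ^+ 2; u ^+ 2; v ^+ 2]).
  by rewrite fE root_prod_XsubC.
(* The elementary symmetric functions of [a, b, c]; below, [p] and [w ^+ 2] are the coefficients of
   [h], and [k] is rational because [p - 2w = (u - v)^2]. *)
pose s1 : rat := a + b + c; pose s2 : rat := a * b + b * c + c * a.
pose s3 : rat := a * b * c; pose p : rat := u ^+ 2 + v ^+ 2.
pose w : rat := u * v; pose n : rat := s2 + w.
pose k : rat := 2%:R * s1 * (u - v); pose m : rat := 2%:R * (n - s1 ^+ 2).
have pE : p = s1 ^+ 2 - 2%:R * s2 by rewrite /p -e1 /s1 /s2; ring.
have sE : 2%:R * s1 * s3 = s2 ^+ 2 - w ^+ 2.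
  by rewrite /w exprMn -e2 /s1 /s2 /s3; ring.
(* [n] is a factor of [s2^2 - w^2 = 2 s1 s3]. *)
have n0 : n != 0.
  have : (s2 - w) * n != 0.
    rewrite (_ : _ * n = 2%:R * s1 * s3) ?sE; last by rewrite /n; ring.
    by rewrite -sE !mulf_neq0.
  by rewrite mulf_eq0 negb_or => /andP[].
have uv : u ^+ 2 != v ^+ 2.
  by move: un => /= /and5P[_ _ _]; rewrite inE.
have k0 : k != 0.
  rewrite !mulf_neq0 // subr_eq0; by apply: contraNneq uv => ->.
have k2E : k ^+ 2 = (2%:R * s1) ^+ 2 * (p - 2%:R * w) by rewrite /k /p /w; ring.
pose h : {poly rat} := ('X - (u ^+ 2)%:P) * ('X - (v ^+ 2)%:P).
have hE : h = 'X ^+ 2 - p%:P * 'X + w%:P ^+ 2 by rewrite /h /p /w; ring.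
pose t : {poly rat} := ('X - (a ^+ 2)%:P) * ('X - (b ^+ 2)%:P) * ('X - (c ^+ 2)%:P).
have tE : t = 'X ^+ 3 - p%:P * 'X ^+ 2 + w%:P ^+ 2 * 'X - s3%:P ^+ 2.
  rewrite -rmorphXn /= /w exprMn -e2 /p -e1 /t /s3; ring.
have fht : f = 'X * h * t by rewrite /f /X_sextic /h /t; ring.
(* Completing the square in [f = (x h)(x h - s3^2)]: [g = x h - s3^2/2]. *)
pose g : {poly rat} := Poly [:: - (s3 ^+ 2 / 2%:R); w ^+ 2; - p; 1].
(* The expansion of [h M / k] with [M = m x + n^2]; below, [q] is the quadratic [Q] of
   [bitangent_identity] made monic, [Q = 2 n q]. *)
pose l : {poly rat} := Poly [:: w ^+ 2 * n ^+ 2 / k; (w ^+ 2 * m - p * n ^+ 2) / k;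
  (n ^+ 2 - p * m) / k; m / k].
pose q : {poly rat} := Poly [:: w * n / 2%:R; (w + 3%:R * s2) / 2%:R - s1 ^+ 2; 1].
have lE : l = k^-1%:P * h * (m%:P * 'X + (n ^+ 2)%:P).
  by rewrite /l /= !cons_poly_def hE; ring.
have q2E : 2%:R * q =
    2%:R * 'X ^+ 2 + (w + 3%:R * s2 - 2%:R * s1 ^+ 2)%:P * 'X + (w * n)%:P.
  have halfE z : 2%:R * (z / 2%:R)%:P = z%:P :> {poly rat}.
    by rewrite -[X in X * _](rmorph_nat (@polyC rat) 2) -rmorphM mulrC divfK.
  rewrite /q /= !cons_poly_def; set z1 := w * n; set z2 := w + _ * s2.
  transitivity (2%:R * 'X ^+ 2 + (2%:R * (z2 / 2%:R)%:P - (2%:R * s1 ^+ 2)%:P) * 'X +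
    2%:R * (z1 / 2%:R)%:P).
    by ring.
  by rewrite !halfE rmorphB.
have hMQ : k%:P ^+ 2 * ('X * t) =
    h * (m%:P * 'X + n%:P ^+ 2) ^+ 2 - (n%:P * (2%:R * q)) ^+ 2.
  have pE' : p%:P = s1%:P ^+ 2 - 2%:R * s2%:P by rewrite pE; ring.
  have sE' : 2%:R * s1%:P * s3%:P = s2%:P ^+ 2 - w%:P ^+ 2.
    by transitivity (2%:R * s1 * s3)%:P; [ring | rewrite sE; ring].
  have k2 : k%:P ^+ 2 = (2%:R * s1%:P) ^+ 2 * (p%:P - 2%:R * w%:P).
    by rewrite -rmorphXn /= k2E; ring.
  by rewrite k2 tE (bitangent_identity 'X pE' sE') hE q2E /m /n; ring.
have kK : k%:P * k^-1%:P = 1 by rewrite -rmorphM mulfV.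
apply: (@jacobian_embedding f mf sf sepf g l q (- (s3 ^+ 2 / 2%:R) ^+ 2)
          (- (2%:R * n / k) ^+ 2) 0 (a ^+ 2) (b ^+ 2) (u ^+ 2) (v ^+ 2)) => //.
- exact: (mask_uniq ur [:: true; true; true; false; true; true]).
- by rewrite /= !rf !inE !eqxx !orbT.
- by rewrite (leq_trans (size_Poly _)).
- by rewrite coef_Poly.
- rewrite fht (_ : t = 'X * h - s3%:P ^+ 2); last by rewrite tE hE; ring.
  rewrite (_ : g = 'X * h - (s3 ^+ 2 / 2%:R)%:P); last first.
    by rewrite /g /= !cons_poly_def hE; ring.
  have -> : s3%:P ^+ 2 = (s3 ^+ 2 / 2%:R)%:P + (s3 ^+ 2 / 2%:R)%:P :> {poly rat}.
    by rewrite -rmorphD -rmorphXn -[X in _ = X%:P]splitr.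
  by ring.
- by rewrite oppr_eq0 expf_neq0 // mulf_neq0 ?expf_neq0 ?invr_neq0 ?mulf_neq0.
- by rewrite (leq_trans (size_Poly _)).
(* The leading coefficient of [l] is [m / k], and [m^2 - k^2 = 4 n^2]. *)
- rewrite coef_Poly /= -subr_eq0 (_ : _ - 1 = (2%:R * n / k) ^+ 2); last first.
    rewrite !expr_div_n -[X in _ - X](divff (expf_neq0 2 k0)) -mulrBl; congr (_ / _).
    by rewrite k2E pE /m /n; ring.
  by rewrite expf_neq0 // !mulf_neq0 ?invr_neq0.
- by rewrite lE !rootM root_XsubC eqxx orbT.
- by rewrite lE !rootM !root_XsubC eqxx !orbT.
- by rewrite oppr_eq0 expf_neq0 // !mulf_neq0 ?invr_neq0.
- by rewrite monicE lead_coefE (@PolyK _ 0) //=.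
- by rewrite (@PolyK _ 0) //= oner_eq0.
transitivity ((- (2%:R * n / k) ^+ 2)%:P * h * q ^+ 2); last by rewrite /h !mulrA.
by rewrite fht (scale_identity _ _ _ kK) hMQ lE; ring.
Qed.

Theorem theorem3p1 (a b c u v : rat) (hP : in_S_open a b c u v) :
  exists phi : {additive 'Z_2 * 'Z_2 * 'Z_2 * 'Z_12 ->
                         jacobian_rat_points (X_sextic a b c u v)},
    injective phi.
Proof.
(* Only [c^2] matters, and [a + b + c], [a + b - c] cannot both vanish. *)
have [s0|] := eqVneq (a + b + c) 0; last exact: X_sextic_embedding.
have cE : X_sextic a b c u v = X_sextic a b (- c) u v by rewrite /X_sextic sqrrN.
rewrite cE; apply: X_sextic_embedding.
  have c4 : (- c) ^+ 4 = c ^+ 4 by ring.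
  by move: hP; rewrite /in_S_open /in_S sqrrN c4 oppr_eq0.
case: hP => _ /and5P[_ _ c0 _ _] _.
have -> : a + b + - c = - (2%:R * c) by rewrite -[RHS]add0r -s0; ring.
by rewrite oppr_eq0 mulf_neq0.
Qed.
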